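(* For every $n\ge1$, $\mathcal{B}(\mathbb{R}^n)\neq\mathcal{B}^{loc}(\mathbb{R}^n)$.
   Context: For a measurable $p:\mathbb{R}^n\to[1,\infty)$ put $p_-=\inf_x p(x)$, $p_+=\sup_x p(x)$; throughout only exponents with $1<p_-\le p_+<\infty$ are considered. $L^{p(\cdot)}(\mathbb{R}^n)$ is the space of measurable functions $f$ with $\int_{\mathbb{R}^n}|f(x)/\lambda|^{p(x)}dx<\infty$ for some $\lambda>0$, with norm $\|f\|_{p(\cdot)}=\inf\{\lambda>0:\int_{\mathbb{R}^n}|f(x)/\lambda|^{p(x)}dx\le1\}$. All cubes have sides parallel to the coordinate axes. $Mf(x)=\sup_{Q\ni x}\frac1{|Q|}\int_Q|f(y)|dy$, the supremum over all cubes $Q$ containing $x$, and $M^{loc}f(x)=\sup_{Q\ni x,\,|Q|\le1}\frac1{|Q|}\int_Q|f(y)|dy$. $\mathcal{B}(\mathbb{R}^n)$ (resp. $\mathcal{B}^{loc}(\mathbb{R}^n)$) is the class of exponents $p(\cdot)$ for which $M$ (resp. $M^{loc}$) is bounded on $L^{p(\cdot)}(\mathbb{R}^n)$. *)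

(* Defs.v *)
From HB Require Import structures.
From mathcomp Require Import all_boot all_order all_algebra.
From mathcomp Require Import all_classical all_reals all_analysis.
From mathcomp Require Import measurable_realfun.

Set Implicit Arguments.
Unset Strict Implicit.
Unset Printing Implicit Defensive.
Import Order.TTheory GRing.Theory Num.Theory.
Import numFieldNormedType.Exports.

Local Open Scope classical_set_scope.
Local Open Scope ring_scope.
Local Open Scope ereal_scope.

(** The library equips [n.-tuple R] with the product (that is, the Borel)
    sigma-algebra.  The n-dimensional Lebesgue measure on Borel sets is the
    iterated product of the one-dimensional one; the second product [\x^] is
    used because it only needs its first factor to be sigma-finite. *)

Section borel_lebesgue.
Context {R : realType}.

Definition tuple_cons n (x : R * n.-tuple R) : n.+1.-tuple R :=
  [tuple of x.1 :: x.2].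

Lemma measurable_tuple_cons n : measurable_fun setT (@tuple_cons n).
Proof. by apply: measurable_cons; [exact: measurable_fst|exact: measurable_snd]. Qed.

Section cons_measure.
Variables (n : nat) (m : {measure set (n.-tuple R) -> \bar R}).

Definition cons_measure : set (n.+1.-tuple R) -> \bar R :=
  pushforward ((@lebesgue_measure R) \x^ m) (@tuple_cons n).

Let cons_measure0 : cons_measure set0 = 0.
Proof. by rewrite /cons_measure /pushforward preimage_set0 measure0. Qed.

Let cons_measure_ge0 A : 0 <= cons_measure A.
Proof. exact: (measure_ge0 ((@lebesgue_measure R) \x^ m)). Qed.

Let cons_measure_sigma_additive : semi_sigma_additive cons_measure.
Proof.
move=> F mF tF mUF; rewrite /cons_measure /pushforward preimage_bigcup.
have mcons A : measurable A -> measurable (@tuple_cons n @^-1` A).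
  by move=> mA; rewrite -[X in measurable X]setTI; exact: measurable_tuple_cons.
apply: measure_semi_sigma_additive => [i| |].
- exact: mcons.
- apply/trivIsetP => i j _ _ ij; rewrite -preimage_setI.
  by move/trivIsetP : tF => /(_ _ _ _ _ ij) ->//; rewrite preimage_set0.
- by rewrite -preimage_bigcup; exact: mcons.
Qed.

HB.instance Definition _ := isMeasure.Build _ _ _ cons_measure
  cons_measure0 cons_measure_ge0 cons_measure_sigma_additive.

End cons_measure.

Fixpoint borel_lebesgue n : {measure set (n.-tuple R) -> \bar R} :=
  match n with
  | 0 => dirac [tuple]
  | n.+1 => cons_measure (borel_lebesgue n)
  end.

End borel_lebesgue.

(** R^n with the Lebesgue sigma-algebra and the (complete) Lebesgue measure,
    obtained by Caratheodory's construction exactly as the library's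
    one-dimensional [completed_lebesgue_measure]. *)

Definition Rn (R : realType) (n : nat) :=
  caratheodory_type ((@borel_lebesgue R n)^*)%mu.

Definition leb (R : realType) (n : nat) : {measure set (Rn R n) -> \bar R} :=
  @completed_measure_extension _ _ _ (@borel_lebesgue R n).

Section variable_exponent.
Context {R : realType} {n : nat}.
Implicit Types (p : Rn R n -> R) (f : Rn R n -> \bar R).

Definition p_minus p : \bar R := ereal_inf (range (EFin \o p)).
Definition p_plus p : \bar R := ereal_sup (range (EFin \o p)).

Definition exponent p : Prop :=
  [/\ measurable_fun setT p, forall x, (1 <= p x)%R,
      1 < p_minus p, p_minus p <= p_plus p & p_plus p < +oo].

Definition modular p f : \bar R := \int[leb R n]_x (`|f x| `^ (p x)).

(** Functions are extended-real-valued, because maximal functions are; the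
    members of L^p(.) are finite almost everywhere. *)
Definition Lvar p f : Prop :=
  measurable_fun setT f /\
  exists2 lambda : R, (0 < lambda)%R &
    modular p (fun x => f x / lambda%:E) < +oo.

Definition Lvar_norm p f : \bar R :=
  ereal_inf [set lambda%:E | lambda in
    [set lambda : R | (0 < lambda)%R /\
                      modular p (fun x => f x / lambda%:E) <= 1]].

Definition bounded_on_Lvar p (T : (Rn R n -> \bar R) -> Rn R n -> \bar R) :=
  exists C : R, forall f, Lvar p f ->
    Lvar p (T f) /\ Lvar_norm p (T f) <= C%:E * Lvar_norm p f.

(** Cubes are closed and non-degenerate; open or half-open cubes give the same
    suprema below. *)
Definition cube (a : n.-tuple R) (l : R) : set (Rn R n) :=
  [set x | forall i, (tnth a i <= tnth x i <= tnth a i + l)%R].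

Definition cubes : set (set (Rn R n)) :=
  [set Q | exists a, exists2 l : R, (0 < l)%R & Q = cube a l].

Definition average f (Q : set (Rn R n)) : \bar R :=
  (leb R n Q)^-1 * \int[leb R n]_(y in Q) `|f y|.

Definition maximal f (x : Rn R n) : \bar R :=
  ereal_sup [set average f Q | Q in [set Q | cubes Q /\ Q x]].

Definition local_maximal f (x : Rn R n) : \bar R :=
  ereal_sup [set average f Q | Q in
    [set Q | [/\ cubes Q, Q x & leb R n Q <= 1]]].

End variable_exponent.

Definition calB (R : realType) (n : nat) : set (Rn R n -> R) :=
  [set p | exponent p /\ bounded_on_Lvar p maximal].

Definition calBloc (R : realType) (n : nat) : set (Rn R n -> R) :=
  [set p | exponent p /\ bounded_on_Lvar p local_maximal].

Arguments calB : clear implicits.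
Arguments calBloc : clear implicits.

(* Main.v *)
Require Import Defs.
From mathcomp Require Import all_boot all_order all_algebra.
From mathcomp Require Import all_classical all_reals all_analysis.
From mathcomp Require Import measurable_realfun.
From mathcomp Require Import ring lra.

(** The separating exponent on R^(n+1) is [p x = 3 + x_0 / (1 + |x|_1)]. Its
    oscillation on a cube of side [l] around [x] is O(l / (1 + |x|_1)), but it
    stays above [3 + 1 / (2n + 3)] on the cube [[L, 2L]^(n+1)] and is at most [3]
    on [[-L, 0]^(n+1)], for every [L >= 1].

    Not in B: [M] maps the indicator of the first cube to a function bounded
    below on the second one, and the two cubes have norms of different order
    as [L] grows.

    In B^loc: if the modular of [f] is at most [1], then for small cubes [Q]
    around [x] the [p x]-th power of the average of [|f|] is controlled by the
    square of the average of [G = |f|^(p/2)], because the average [b] satisfies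
    [b <= |Q|^-1], which makes [b^(p y - p x)] bounded, unless [b] is smaller
    than the integrable weight [exp(- c (1 + |x|_1))], an error one can afford.
    It remains to bound the maximal operator on [L^2], which follows from
    Vitali's covering argument and Marcinkiewicz interpolation. *)

Set Implicit Arguments.
Unset Strict Implicit.
Unset Printing Implicit Defensive.
Import Order.TTheory GRing.Theory Num.Theory.
Import numFieldNormedType.Exports.

Local Open Scope classical_set_scope.
Local Open Scope ring_scope.
Local Open Scope ereal_scope.

(** * Lebesgue measure of cubes *)

Section leb_cubes.
Context {R : realType}.

Lemma measurable_borel n (A : set (n.-tuple R)) :
  measurable A -> measurable (A : set (Rn R n)).
Proof. exact: (@caratheodory_measurable_mu_ext _ _ _ (@borel_lebesgue R n)). Qed.

Lemma leb_borel n (A : set (n.-tuple R)) : measurable A ->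
  leb R n A = borel_lebesgue n A.
Proof. exact: measurable_mu_extE. Qed.

Lemma measurable_coord n (i : 'I_n) :
  measurable_fun [set: Rn R n] (fun x : Rn R n => tnth x i).
Proof.
move=> _ Y mY; apply: measurableI => //.
apply: measurable_borel; rewrite -[X in measurable X]setTI.
exact: measurable_tnth.
Qed.

Lemma cubeE n (a : n.-tuple R) (l : R) :
  cube a l = \bigcap_(i in [set: 'I_n])
    ((fun x : n.-tuple R => tnth x i) @^-1` `[tnth a i, (tnth a i + l)%R]%classic).
Proof.
apply/seteqP; split=> [x xa i _ /=|x xa i]; first by rewrite in_itv /= xa.
by have /= := xa i Logic.I; rewrite in_itv.
Qed.

Lemma measurable_cube_borel n (a : n.-tuple R) (l : R) :
  measurable (cube a l : set (n.-tuple R)).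
Proof.
rewrite cubeE; apply: fin_bigcap_measurable => [|i _].
  exact: finite_finset.
rewrite -[X in measurable X]setTI.
exact: (@measurable_tnth _ _ n i).
Qed.

Lemma measurable_cube n (a : n.-tuple R) (l : R) : measurable (cube a l).
Proof. apply: measurable_borel; exact: measurable_cube_borel. Qed.

Lemma leb_cube n (a : n.-tuple R) (l : R) : (0 < l)%R ->
  leb R n (cube a l) = (l ^+ n)%:E.
Proof.
move=> l0; rewrite leb_borel; last exact: measurable_cube_borel.
elim: n a => [|n IHn] a /=.
  by rewrite /dirac /= indicE expr0 mem_set// => -[].
rewrite /cons_measure /pushforward.
have -> : @tuple_cons R n @^-1` cube a l =
    `[thead a, (thead a + l)%R]%classic `*` (cube (behead_tuple a) l : set (n.-tuple R)).
  apply/seteqP; split=> [[x y] /= xy|[x y] /= [xa yb] i].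
    split; first by have := xy ord0; rewrite in_itv /= tnth0.
    move=> i; have := xy (lift ord0 i).
    by rewrite tnthS /= [in tnth a _](tuple_eta a) tnthS.
  case: (unliftP ord0 i) => [j ->|->].
    by rewrite tnthS /= [in tnth a _](tuple_eta a) tnthS; exact: yb.
  by rewrite /tuple_cons tnth0; move: xa; rewrite in_itv.
rewrite product_measure2E//=; last exact: measurable_cube_borel.
rewrite IHn lebesgue_measure_itv/= lte_fin ltrDl l0 -EFinD -EFinM exprS.
by rewrite [(_ + l - _)%R]addrC addKr.
Qed.
End leb_cubes.

(** * Maximal operators over cubes *)

Section maximal_measurable.
Context {R : realType} {n : nat}.
Implicit Types (f : Rn R n -> \bar R) (a : n.-tuple R) (c : \bar R).

(* The side length is bounded strictly, so that a cube can be enlarged to one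
   with rational corner and side; for cubes of volume at most [1] this does not
   change the supremum. *)
Definition cube_maximal c f (x : Rn R n) : \bar R :=
  ereal_sup [set average f Q | Q in
    [set Q | exists a, exists2 l : R, (0 < l)%R /\ l%:E < c &
             Q = cube a l /\ Q x]].

Definition rat_cube (q : n.-tuple rat * rat) : set (Rn R n) :=
  cube [tuple ratr (tnth q.1 i) | i < n] (ratr q.2).

Definition heavy c f (r : R) (q : n.-tuple rat * rat) : Prop :=
  [/\ (0 < q.2)%R, (ratr q.2)%:E < c &
    (r * ratr q.2 ^+ n)%:E < \int[leb R n]_(y in rat_cube q) `|f y|].

Lemma measurable_rat_cube q : measurable (rat_cube q).
Proof. exact: measurable_cube. Qed.

Lemma average_cube f a (l : R) : (0 < l)%R ->
  average f (cube a l) = ((l ^+ n)^-1)%:E * \int[leb R n]_(y in cube a l) `|f y|.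
Proof.
by move=> l0; rewrite /average leb_cube// inver gt_eqF// exprn_gt0.
Qed.

Lemma lt_average_cube f a (l r : R) : (0 < l)%R ->
  (r%:E < average f (cube a l)) =
  ((r * l ^+ n)%:E < \int[leb R n]_(y in cube a l) `|f y|).
Proof.
move=> l0; rewrite average_cube// lte_pdivlMl ?exprn_gt0//.
by rewrite -EFinM mulrC.
Qed.

(** Each corner coordinate moves down by less than [ratr s - l], the gain in side length, so the
    upper faces stay covered. *)
Lemma sub_rat_cube a (l m : R) : (0 <= l < m)%R ->
  exists2 q, (0 < q.2)%R /\ (l < ratr q.2 < m)%R & cube a l `<=` rat_cube q.
Proof.
move=> /andP[l0 lm]; have [s] := rat_in_itvoo lm.
rewrite in_itv/= => /andP[ls sm].
have /choice[b bP] : forall i : 'I_n, exists q : rat,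
    (tnth a i - (ratr s - l) < ratr q < tnth a i)%R.
  move=> i; have /rat_in_itvoo[q] : (tnth a i - (ratr s - l) < tnth a i)%R.
    by rewrite ltrBlDr ltrDl subr_gt0.
  by rewrite in_itv/= => qP; exists q.
exists ([tuple b i | i < n], s) => /=.
  by rewrite ls sm -(ltr0q R) (le_lt_trans l0).
move=> x xa i; rewrite !tnth_mktuple.
have /andP[b1 b2] := bP i; have /andP[x1 x2] := xa i.
rewrite /=; apply/andP; split; lra.
Qed.

(** Rational enlargements of a cube must keep two strict inequalities, on the side and on the
    integral; both are open conditions on the side length. *)
Lemma scaled_power_lt (r l : R) (I c : \bar R) : l%:E < c ->
  (r * l ^+ n)%:E < I ->
  exists2 m : R, (l < m)%R & forall k, (l < k < m)%R ->
    k%:E < c /\ (r * k ^+ n)%:E < I.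
Proof.
move=> lc lI.
(* Real thresholds [c'] and [I'] stand in for [c] and [I], which may be infinite, so that continuity
   of the power applies. *)
have [c' lc' c'c] : exists2 c' : R, (l < c')%R & c'%:E <= c.
  case: c lc => [c|_|//]; first by rewrite lte_fin => lc; exists c.
  by exists (l + 1)%R; rewrite ?ltrDl// leey.
have [I' lI' I'I] : exists2 I' : R, (r * l ^+ n < I')%R & I'%:E <= I.
  case: I lI => [I|_|//]; first by rewrite lte_fin => lI; exists I.
  by exists (r * l ^+ n + 1)%R; rewrite ?ltrDl// leey.
have cont : (fun k : R => r * k ^+ n)%R @ l --> (r * l ^+ n)%R.
  by apply: cvgMr; exact: exprn_continuous.
have : \forall k \near l, (r * k ^+ n < I')%R by exact: cvgr_lt cont _ lI'.
move=> /nbhs_ballP[e /= e0 eP].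
exists (Num.min c' (l + e)%R); first by rewrite lt_min lc' ltrDl.
move=> k; rewrite lt_min => /and3P[lk kc' kle]; split.
  by rewrite (lt_le_trans _ c'c)// lte_fin.
rewrite (lt_le_trans _ I'I)// lte_fin; apply: eP => /=.
by rewrite /ball/= ltr_distlC; apply/andP; split; lra.
Qed.

(** Any cube witnessing the inequality lies in a slightly larger rational one that still witnesses
    it. The countable union yields measurability, and later the family for the covering argument. *)
Lemma cube_maximal_gtP c f (r : R) : measurable_fun setT f ->
  [set x | r%:E < cube_maximal c f x] = \bigcup_(q in heavy c f r) rat_cube q.
Proof.
move=> mf; apply/seteqP; split=> [x /=|].
  move=> /ereal_sup_gt[_ [_ [a [l [l0 lc] [-> xa]]] <-]].
  rewrite lt_average_cube// => fl.
  have [m lm mP] := scaled_power_lt lc fl.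
  have /(sub_rat_cube a)[q [q0 qlm] aq] : (0 <= l < m)%R by rewrite ltW.
  have [qc qf] := mP _ qlm.
  exists q; last exact: aq.
  split => //; apply: (lt_le_trans qf).
  apply: ge0_subset_integral.
  - exact: measurable_cube.
  - exact: measurable_rat_cube.
  - apply: measurable_funTS; apply: measurableT_comp mf; exact: abse_measurable.
  - by move=> y _; exact: abse_ge0.
  - exact: aq.
move=> x [q [q0 qc fq] qx] /=.
have q0' : (0 < ratr q.2 :> R)%R by rewrite ltr0q.
apply: (@lt_le_trans _ _ (average f (rat_cube q))).
  by rewrite lt_average_cube.
apply: ereal_sup_ubound; exists (rat_cube q) => //.
by exists [tuple ratr (tnth q.1 i) | i < n], (ratr q.2).
Qed.

Lemma measurable_cube_maximal c f : measurable_fun setT f ->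
  measurable_fun setT (cube_maximal c f).
Proof.
move=> mf _; apply: (measurability _ (ErealGenOInfty.measurableE R)) => //.
move=> _ [_ [r ->] <-]; rewrite setTI preimage_itvoy cube_maximal_gtP//.
rewrite bigcup_mkcond; apply: countable_bigcupT_measurable => // q.
by case: ifPn => // _; exact: measurable_rat_cube.
Qed.

(** For [c <= 0] no cube is admissible and the supremum is [-oo]; for [0 < c] a cube with corner [x]
    has a nonnegative average. *)
Lemma cube_maximal_ge0 c f x : 0 < c -> 0 <= cube_maximal c f x.
Proof.
move=> c0.
have [l l0 lc] : exists2 l : R, (0 < l)%R & l%:E < c.
  case: c c0 => [c|_|//]; last by exists 1%R; rewrite ?ltry.
  rewrite lte_fin => c0; exists (c / 2)%R; first lra.
  by rewrite lte_fin; lra.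
apply: (@le_trans _ _ (average f (cube x l))).
  rewrite average_cube// mule_ge0 ?integral_ge0//.
  by rewrite lee_fin invr_ge0 exprn_ge0// ltW.
apply: ereal_sup_ubound; exists (cube x l) => //; exists x, l => //.
by split => // i; rewrite lexx lerDl ltW.
Qed.

Lemma maximalE f : maximal f = cube_maximal +oo f.
Proof.
apply/funext => x; congr ereal_sup; apply/seteqP; split.
  move=> _ [Q [[a [l l0 ->]] xQ] <-]; exists (cube a l) => //.
  by exists a, l => //; rewrite ltry.
move=> _ [Q [a [l [l0 _] [-> xQ]]] <-]; exists (cube a l) => //.
by split => //; exists a, l.
Qed.

End maximal_measurable.

Lemma subset_measure d (T : measurableType d) (R : realType)
    (mu : {measure set T -> \bar R}) (A B : set T) :
  measurable A -> measurable B -> A `<=` B -> mu A <= mu B.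
Proof. by move=> mA mB AB; apply: le_measure; rewrite ?inE. Qed.

Lemma measure_setD_eq0 d (T : measurableType d) (R : realType)
    (mu : {measure set T -> \bar R}) (A B : set T) :
  measurable A -> measurable B -> B `<=` A -> mu A < +oo -> mu A <= mu B ->
  mu (A `\` B) = 0.
Proof.
move=> mA mB BA Aoo AB.
have -> : mu (A `\` B) = mu A - mu B.
  by have := measureD mA mB Aoo; rewrite (setIidr BA).
have muBA : mu B <= mu A by exact: subset_measure.
have Bfin : mu B \is a fin_num by rewrite ge0_fin_numE// (le_lt_trans muBA).
have -> : mu A = mu B by apply/eqP; rewrite eq_le AB muBA.
exact: subee.
Qed.

Lemma integral_bigcup_le d (T : measurableType d) (R : realType)
    (mu : {measure set T -> \bar R}) (f : T -> \bar R) (F : (set T)^nat) c :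
  measurable_fun setT f -> (forall x, 0 <= f x) ->
  (forall k, measurable (F k)) -> nondecreasing_seq F ->
  (forall k, \int[mu]_(x in F k) f x <= c) ->
  \int[mu]_(x in \bigcup_k F k) f x <= c.
Proof.
move=> mf f0 mF ndF Fc.
have cF : \int[mu]_(x in F k) f x @[k --> \oo] -->
    \int[mu]_(x in \bigcup_k F k) f x.
  apply: ge0_nondecreasing_set_cvg_integral => // k.
  exact: measurable_funTS.
rewrite -(cvg_lim _ cF)//; apply: lime_le; last exact: nearW.
by apply/cvg_ex; eexists; exact: cF.
Qed.

(** * Cubes of volume one in the local maximal operator *)

Section local_maximal_cubes.
Context {R : realType} {n : nat}.
Implicit Types (f : Rn R n -> \bar R) (a : n.-tuple R).

(** A cube of side exactly [1] is not admissible for [cube_maximal 1]. Admissible cubes containing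
    [x] exhaust it up to a null set, and monotone convergence passes their bound to the limit. *)
Lemma le_integral_unit_cube f a (x : Rn R n) : measurable_fun setT f ->
  cube a 1 x ->
  \int[leb R n]_(y in cube a 1) `|f y| <= cube_maximal 1 f x.
Proof.
move=> mf xa; set s := cube_maximal 1 f x.
have s0 : 0 <= s by exact: cube_maximal_ge0.
have maf : measurable_fun setT (fun y => `|f y|) by exact: measurableT_comp.
(* The shift [k.+2] starts the sequence at [1/2], so that every side [1 - d k] is positive. *)
pose d k : R := (k.+2%:R)^-1%R.
have d01 k : (0 < d k < 1)%R.
  by rewrite /d invr_gt0 ltr0n/= invf_lt1 ?ltr0n// ltr1n.
(* [F k] is the image of the unit cube under the homothety with centre [x] and ratio [1 - d k]: it
   contains [x] and grows with [k]. *)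
pose c k := [tuple tnth a i + d k * (tnth x i - tnth a i) | i < n]%R.
pose F k : set (Rn R n) := cube (c k) (1 - d k)%R.
have mF k : measurable (F k) by exact: measurable_cube.
have x01 i : (0 <= tnth x i - tnth a i <= 1)%R.
  by have /andP[? ?] := xa i; apply/andP; split; lra.
have ndF : nondecreasing_seq F.
  move=> j k jk; apply/subsetPset => y yF i.
  have := yF i; rewrite !tnth_mktuple => /andP[y1 y2].
  have /andP[x0 x1] := x01 i.
  have dkj : (d k <= d j)%R by rewrite lef_pV2 ?posrE ?ltr0n// ler_nat !ltnS.
  by apply/andP; split; nra.
have FQ k : F k `<=` cube a 1.
  move=> y yF i; have := yF i; rewrite !tnth_mktuple => /andP[y1 y2].
  have /andP[x0 x1] := x01 i; have /andP[d0 d1] := d01 k.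
  by apply/andP; split; nra.
have UQ : \bigcup_k F k `<=` cube a 1 by move=> y [k _]; exact: FQ.
have mU : measurable (\bigcup_k F k) by exact: bigcupT_measurable.
have mQ := measurable_cube a 1.
have muQ : leb R n (cube a 1) = 1 by rewrite leb_cube// expr1n.
have QU0 : leb R n (cube a 1 `\` \bigcup_k F k) = 0.
  apply: measure_setD_eq0 => //; rewrite muQ ?ltry//.
  have cd : ((1 - d k) ^+ n)%R @[k --> \oo] --> ((1 - 0) ^+ n : R)%R.
    have c1 : (1 - d k)%R @[k --> \oo] --> (1 - 0 : R)%R.
      apply: cvgB; first exact: cvg_cst.
      by rewrite (cvg_shiftS (@harmonic R)); exact: cvg_harmonic.
    exact: (cvg_comp _ _ c1 (@exprn_continuous R n (1 - 0)%R)).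
  rewrite subr0 expr1n in cd.
  have Ufin : leb R n (\bigcup_k F k) \is a fin_num.
    rewrite ge0_fin_numE// (@le_lt_trans _ _ (leb R n (cube a 1)))//.
      exact: subset_measure.
    by rewrite muQ ltry.
  rewrite -(fineK Ufin) lee_fin.
  rewrite -(cvg_lim _ cd)//; apply: limr_le.
    by apply/cvg_ex; eexists; exact: cd.
  apply: nearW => k.
  rewrite -lee_fin (fineK Ufin) -(leb_cube (c k)); last first.
    by have /andP[? ?] := d01 k; lra.
  by apply: subset_measure; [exact: mF|exact: mU|move=> y yF; exists k].
have mQU : measurable (cube a 1 `\` \bigcup_k F k) by exact: measurableD.
have mfQ : measurable_fun (cube a 1) (fun y => `|f y|) by exact: measurable_funTS.
have f0Q y : cube a 1 y -> 0 <= `|f y| by move=> _; exact: abse_ge0.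
rewrite (ge0_negligible_integral mQU mQ mfQ f0Q QU0).
rewrite setDD (setIidr UQ).
apply: integral_bigcup_le => // k.
have dk0 : (0 < 1 - d k)%R by have /andP[? ?] := d01 k; lra.
have : average f (F k) <= s.
  apply: ereal_sup_ubound; exists (F k) => //.
  exists (c k), (1 - d k)%R.
    by split=> //; rewrite lte_fin; have /andP[? ?] := d01 k; lra.
  split=> // i; rewrite !tnth_mktuple.
  have /andP[x0 x1] := x01 i; have /andP[d0 d1] := d01 k.
  by apply/andP; split; nra.
rewrite average_cube// lee_pdivrMl ?exprn_gt0// => /le_trans; apply.
rewrite -[leRHS]mul1e lee_wpmul2r// lee_fin exprn_ile1//; first exact: ltW.
by have /andP[? ?] := d01 k; lra.
Qed.

(** In positive dimension, volume at most [1] means side at most [1]; the only sides missing from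
    [cube_maximal 1] are those equal to [1], treated by the previous lemma. *)
Lemma local_maximalE f : (0 < n)%N -> measurable_fun setT f ->
  local_maximal f = cube_maximal 1 f.
Proof.
move=> n0 mf; apply/funext => x; apply/eqP; rewrite eq_le; apply/andP; split.
  apply: ge_ereal_sup => _ [_ [[a [l l0 ->]] xQ Q1] <-].
  have l_le1 : (l <= 1)%R.
    by move: Q1; rewrite leb_cube// lee_fin expr_le1 ?(ltW l0).
  have [l1|l1] := eqVneq l 1%R.
    rewrite l1 in xQ *; rewrite average_cube// expr1n invr1 mul1e.
    exact: le_integral_unit_cube.
  apply: ereal_sup_ubound; exists (cube a l) => //.
  exists a, l => //; split => //.
  by rewrite lte_fin lt_neqAle; apply/andP.
apply: le_ereal_sup => _ [Q [a [l [l0 l1] [-> xQ]]] <-]; exists (cube a l) => //.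
split => //; first by exists a, l.
by rewrite leb_cube// lee_fin exprn_ile1//; exact: ltW.
Qed.

End local_maximal_cubes.

(** * The weak-type inequality *)

(** The covering argument below handles finite families only. The members of [P] with code below [K]
    form such families and exhaust [P]. *)
Lemma measure_bigcup_countable_le d (T : measurableType d) (R : realType)
    (mu : {measure set T -> \bar R}) (I : countType) (P : set I)
    (F : I -> set T) c :
  (forall i, measurable (F i)) ->
  (forall s : seq I, (forall i, i \in s -> P i) ->
    mu (\bigcup_(i in [set` s]) F i) <= c) ->
  mu (\bigcup_(i in P) F i) <= c.
Proof.
move=> mF Fc.
pose s K := [seq i <- pmap (@unpickle I) (iota 0 K) | i \in P].
have sP K i : i \in s K -> P i by rewrite mem_filter => /andP[/set_mem].
pose G K := \bigcup_(i in [set` s K]) F i.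
have mG K : measurable (G K) by apply: fin_bigcup_measurable.
have GP : \bigcup_K G K = \bigcup_(i in P) F i.
  apply/seteqP; split=> [x [K _ [i /= iK Fi]]|x [i Pi Fi]].
    by exists i => //; exact: sP iK.
  exists (pickle i).+1 => //; exists i => //.
  change (i \in s (pickle i).+1); rewrite mem_filter mem_set//.
  rewrite mem_pmap; apply/mapP; exists (pickle i).
    by rewrite mem_iota add0n leq0n/=.
  by rewrite pickleK.
have ndG : nondecreasing_seq G.
  move=> j k jk; apply/subsetPset => x [i /= ij Fi]; exists i => //=.
  move: ij; rewrite /s !mem_filter => /andP[iP]; rewrite iP !mem_pmap.
  move=> /mapP[m mj im]; apply/mapP; exists m => //.
  by move: mj; rewrite !mem_iota !add0n !leq0n => /leq_trans; apply.
have cG : mu (G K) @[K --> \oo] --> mu (\bigcup_K G K).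
  apply: nondecreasing_cvg_mu => //; exact: bigcupT_measurable.
rewrite -GP -(cvg_lim _ cG)//; apply: lime_le.
  by apply/cvg_ex; eexists; exact: cG.
by apply: nearW => K /=; apply: Fc => i; exact: sP.
Qed.

Section above.
Context d (T : measurableType d) (R : realType).
Implicit Types (f : T -> \bar R).

(** The large part in the splitting of [f] at height [t]; it keeps the full value of [|f|], not the
    excess over [t]. *)
Definition above (t : R) f x : \bar R := if t%:E < `|f x| then `|f x| else 0.

Lemma above_ge0 t f x : 0 <= above t f x.
Proof. by rewrite /above; case: ifP. Qed.

Lemma measurable_above t f : measurable_fun setT f ->
  measurable_fun setT (above t f).
Proof.
move=> mf.
have maf : measurable_fun setT (fun y => `|f y|) by exact: measurableT_comp.
by apply: measurable_fun_ifT => //; exact: measurable_fun_lte.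
Qed.

Lemma integral_above (mu : {measure set T -> \bar R}) (A : set T) t f :
  measurable A -> measurable_fun setT f -> (0 <= t)%R ->
  \int[mu]_(y in A) `|f y| <= t%:E * mu A + \int[mu]_(y in A) `|above t f y|.
Proof.
move=> mA mf t0.
have maf : measurable_fun A (fun y => `|f y|).
  by apply: measurable_funTS; exact: measurableT_comp.
have maaf : measurable_fun A (fun y => `|above t f y|).
  by apply: measurable_funTS; apply: measurableT_comp => //; exact: measurable_above.
rewrite -integral_cst// -ge0_integralD//.
apply: ge0_le_integral => //; first exact: emeasurable_funD.
move=> y _; rewrite /above; case: ifPn => [|].
  by rewrite abse_id leeDr ?lee_fin.
by rewrite -leNgt abse0 adde0.
Qed.

End above.

Section weak_type.
Context {R : realType} {n : nat}.
Implicit Types (f g : Rn R n -> \bar R) (c : \bar R).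

Let cubes_of (s : seq (n.-tuple R * R)) : set (Rn R n) :=
  \bigcup_(q in [set` s]) cube q.1 q.2.

Let cubes_of_nil : cubes_of [::] = set0.
Proof. by apply/seteqP; split => x // []. Qed.

Let measurable_cubes_of s : measurable (cubes_of s).
Proof. by apply: fin_bigcup_measurable => // q _; exact: measurable_cube. Qed.

Lemma cube_triple (a b : n.-tuple R) (l m : R) : (m <= l)%R ->
  cube a l `&` cube b m !=set0 ->
  cube b m `<=` cube [tuple tnth a i - l | i < n]%R (3 * l)%R.
Proof.
move=> ml [z [za zb]] x xb i; rewrite tnth_mktuple.
have /andP[? ?] := za i; have /andP[? ?] := zb i; have /andP[? ?] := xb i.
by apply/andP; split; lra.
Qed.

Lemma largest_cube (s : seq (n.-tuple R * R)) : s != [::] ->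
  exists2 q, q \in s & forall q', q' \in s -> (q'.2 <= q.2)%R.
Proof.
elim: s => // q [|q1 s] IH _.
  by exists q; rewrite ?mem_head// => q'; rewrite inE => /eqP->.
have [//|q2 q2s q2max] := IH.
have [qq2|qq2] := leP q.2 q2.2.
  exists q2; first by rewrite inE q2s orbT.
  by move=> q'; rewrite inE => /predU1P[->//|]; exact: q2max.
exists q; rewrite ?mem_head// => q'; rewrite inE => /predU1P[->//|/q2max q'2].
exact: le_trans q'2 (ltW qq2).
Qed.

(* Vitali: keep the largest cube, discard those that meet it (they lie in its
   threefold dilation) and recurse on the others. *)
Lemma leb_heavy_cubes g (t : R) (s : seq (n.-tuple R * R)) :
  measurable_fun setT g -> (forall x, 0 <= g x) -> (0 < t)%R ->
  (forall q, q \in s -> (0 < q.2)%R) ->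
  (forall q, q \in s ->
    (t * q.2 ^+ n)%:E <= \int[leb R n]_(y in cube q.1 q.2) g y) ->
  leb R n (cubes_of s) <= (3 ^+ n / t)%:E * \int[leb R n]_(y in cubes_of s) g y.
Proof.
move=> mg g0 t0.
have [k sk] : exists k, (size s <= k)%N by exists (size s).
elim: k s sk => [|k IH] s sk s0 sg.
  move: sk; rewrite leqn0 size_eq0 => /eqP->.
  by rewrite cubes_of_nil measure0 integral_set0 mule0.
have [->|sn0] := eqVneq s [::].
  by rewrite cubes_of_nil measure0 integral_set0 mule0.
have [[a l] als alP] := largest_cube sn0.
have l0 : (0 < l)%R := s0 _ als.
pose s2 := [seq q <- s | `[< cube a l `&` cube q.1 q.2 = set0 >]].
have s2s q : q \in s2 -> q \in s by rewrite mem_filter => /andP[].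
have aa : cube a l a by move=> i; rewrite lexx lerDl ltW.
(* The chosen cube contains its corner [a], hence meets itself and is discarded: the list gets
   shorter. *)
have sz2 : (size s2 <= k)%N.
  rewrite -ltnS (leq_trans _ sk)// size_filter ltn_neqAle count_size andbT.
  rewrite -all_count; apply/allPn; exists (a, l) => //=.
  by apply/asboolPn; rewrite setIid => a0; have : set0 a by rewrite -a0.
pose Q3 := cube [tuple tnth a i - l | i < n]%R (3 * l)%R : set (Rn R n).
have mQ3 : measurable Q3 by exact: measurable_cube.
have mQ : measurable (cube a l) by exact: measurable_cube.
have sub : cubes_of s `<=` Q3 `|` cubes_of s2.
  move=> x [q /= qs qx].
  have [q2|q2] := pselect (cube a l `&` cube q.1 q.2 = set0).
    by right; exists q => //=; rewrite mem_filter qs andbT; exact/asboolP.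
  left; apply: (@cube_triple a q.1 l q.2) => //; first exact: alP qs.
  exact/set0P/eqP.
have dis : [disjoint cube a l & cubes_of s2].
  rewrite disj_set2E; apply/eqP/seteqP; split => // x [xa [q /= + xq]].
  rewrite mem_filter => /andP[/asboolP q0 _].
  by have : set0 x by rewrite -q0.
have dom : cube a l `|` cubes_of s2 `<=` cubes_of s.
  move=> x [xa|[q /= q2 xq]]; first by exists (a, l).
  by exists q => //; exact: s2s.
have mug A : measurable_fun A g by exact: measurable_funTS.
apply: (@le_trans _ _ (leb R n (Q3 `|` cubes_of s2))).
  by apply: subset_measure => //; exact: measurableU.
apply: (@le_trans _ _ (leb R n Q3 + leb R n (cubes_of s2))); first exact: measureU2.
(* Dilation multiplies the volume of the chosen cube by [3 ^+ n], and the integral over that cube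
   pays for it; the remaining cubes follow by induction. *)
apply: (@le_trans _ _ ((3 ^+ n / t)%:E * \int[leb R n]_(y in cube a l) g y +
    (3 ^+ n / t)%:E * \int[leb R n]_(y in cubes_of s2) g y)).
  apply: leeD; last by apply: IH => // q /s2s; [exact: s0|exact: sg].
  rewrite leb_cube ?mulr_gt0// exprMn.
  apply: le_trans (_ : (3 ^+ n / t)%:E * (t * l ^+ n)%:E <= _).
    by rewrite -EFinM lee_fin mulrA divfK ?gt_eqF.
  apply: lee_wpmul2l; last exact: (sg _ als).
  by rewrite lee_fin divr_ge0 ?exprn_ge0 ?ltW.
rewrite -ge0_muleDr; [|exact: integral_ge0|exact: integral_ge0].
apply: lee_wpmul2l; first by rewrite lee_fin divr_ge0 ?exprn_ge0 ?ltW.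
(* The chosen cube is disjoint from the remaining ones, so the two integrals merge. *)
rewrite -ge0_integral_setU//.
by apply: ge0_subset_integral => //; exact: measurableU.
Qed.

Lemma leb_cube_maximal_gt c f (t : R) : measurable_fun setT f -> (0 < t)%R ->
  leb R n [set x | t%:E < cube_maximal c f x] <=
  (3 ^+ n / t)%:E * \int[leb R n]_y `|f y|.
Proof.
move=> mf t0; rewrite cube_maximal_gtP//.
have maf : measurable_fun setT (fun y => `|f y|) by exact: measurableT_comp.
apply: measure_bigcup_countable_le => [q|s sh]; first exact: measurable_rat_cube.
pose real_cube (q : n.-tuple rat * rat) : n.-tuple R * R :=
  ([tuple ratr (tnth q.1 i) | i < n], ratr q.2).
have -> : \bigcup_(i in [set` s]) rat_cube i = cubes_of (map real_cube s).
  apply/seteqP; split=> [x [q /= qs xq]|x [_ /= /mapP[q qs ->] xq]].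
    by exists (real_cube q) => //=; exact: map_f.
  by exists q.
apply: le_trans (@leb_heavy_cubes (fun y => `|f y|) t _ maf _ t0 _ _) _ => //.
- by move=> _ /mapP[q /sh[q0 _ _] ->]; rewrite ltr0q.
- by move=> _ /mapP[q /sh[_ _ /ltW qt] ->].
apply: lee_wpmul2l; first by rewrite lee_fin divr_ge0 ?exprn_ge0 ?ltW.
exact: ge0_subset_integral.
Qed.

Lemma cube_maximal_above c f (t : R) x : measurable_fun setT f -> (0 <= t)%R ->
  cube_maximal c f x <= t%:E + cube_maximal c (above t f) x.
Proof.
move=> mf t0; apply: ge_ereal_sup => _ [_ [a [l [l0 lc] [-> xa]]] <-].
have maf : measurable_fun setT (fun y => `|f y|) by exact: measurableT_comp.
have mab := measurable_above t mf.
have maab : measurable_fun setT (fun y => `|above t f y|) by exact: measurableT_comp.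
have mQ : measurable (cube a l) by exact: measurable_cube.
apply: (@le_trans _ _ (t%:E + average (above t f) (cube a l))); last first.
  apply: leeD2l; apply: ereal_sup_ubound; exists (cube a l) => //.
  by exists a, l.
have ln0 : (0 < l ^+ n)%R by rewrite exprn_gt0.
rewrite !average_cube// lee_pdivrMl// ge0_muleDr ?lee_fin//; last first.
  by rewrite mule_ge0 ?integral_ge0// lee_fin invr_ge0 ltW.
rewrite muleA -[X in _ <= _ + X * _]EFinM divff ?gt_eqF// mul1e -EFinM.
by apply: (le_trans (integral_above _ _ mf t0)); rewrite ?leb_cube// mulrC.
Qed.

(** The values of [|f|] up to [t] add at most [t] to any average, so exceeding [2 * t] forces the
    maximal function of [above t f] to exceed [t]; the weak-type bound is applied to that part
    only. *)
Lemma leb_cube_maximal_gt2 c f (t : R) : measurable_fun setT f -> (0 < t)%R ->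
  leb R n [set x | (2 * t)%:E < cube_maximal c f x] <=
  (3 ^+ n / t)%:E * \int[leb R n]_y above t f y.
Proof.
move=> mf t0; have mab := measurable_above t mf.
have mgt h (r : R) : measurable_fun setT h ->
    measurable [set x | r%:E < cube_maximal c h x].
  move=> mh; rewrite -[X in measurable X]setTI.
  apply: emeasurable_fun_o_infty; first exact: measurableT.
  exact: measurable_cube_maximal.
apply: (@le_trans _ _ (leb R n [set x | t%:E < cube_maximal c (above t f) x])).
  apply: subset_measure; [exact: mgt|exact: mgt|move=> x /= tx].
  have := lt_le_trans tx (cube_maximal_above c x mf (ltW t0)).
  by rewrite mulr_natl mulr2n EFinD lteD2lE.
have := leb_cube_maximal_gt c mab t0.
under eq_integral do rewrite gee0_abs ?above_ge0//.
exact.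
Qed.

End weak_type.

(** * Interpolation *)

Section interpolation.
Context {R : realType}.

Lemma pow2_unbounded (tau y : R) : (0 < tau)%R -> exists j, (y <= tau * 2 ^+ j)%R.
Proof.
move=> tau0; exists (Num.bound (y / tau)).
have := upper_nthrootP (leqnn (Num.bound (y / tau))).
by rewrite ltr_pdivrMr// mulrC => /ltW.
Qed.

(** The levels below [u] form a geometric progression, whose sum is less than twice its last
    term. *)
Lemma sum_dyadic_le (tau : R) (u : \bar R) J : (0 < tau)%R -> 0 <= u ->
  \sum_(0 <= j < J) (if (tau * 2 ^+ j)%:E < u then (tau * 2 ^+ j)%:E else 0) <=
  2%:E * u.
Proof.
move=> tau0; case: u => [u|_|//]; last first.
  by rewrite gt0_muley ?lte_fin// leey.
rewrite lee_fin => u0.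
pose a j : R := (if tau * 2 ^+ j < u then tau * 2 ^+ j else 0)%R.
rewrite [leLHS](_ : _ = (\sum_(0 <= j < J) a j)%:E); last first.
  by rewrite -sumEFin; apply: eq_bigr => j _; rewrite lte_fin /a; case: ifP.
rewrite -EFinM lee_fin.
(* The second bound is what carries the induction: when the level [tau * 2 ^+ J] is below [u], the
   earlier levels add up to at most that level. *)
suff /andP[] : (\sum_(0 <= j < J) a j <= 2 * u)%R &&
  (\sum_(0 <= j < J) a j <= tau * 2 ^+ J)%R by [].
elim: J => [|J /andP[IH1 IH2]].
  by rewrite big_geq// mulr_ge0//= mulr_ge0 ?ltW.
rewrite big_nat_recr//= exprS.
have tJ : (0 < tau * 2 ^+ J)%R by rewrite mulr_gt0 ?exprn_gt0.
have [[-> uJ]|->] : (a J = tau * 2 ^+ J /\ tau * 2 ^+ J < u)%R \/ a J = 0%R.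
- by rewrite /a; case: ifP; [left|right].
- by apply/andP; split; lra.
- by apply/andP; split; lra.
Qed.

(** One term is enough. For real [m], take the least [k] with [m <= 4 * (tau * 2 ^+ k)]: minimality,
    or the hypothesis when [k = 0], puts [m] above half that value, so the term of index [k] is
    present. *)
Lemma sqr_le_dyadic (tau : R) (m : \bar R) : (0 < tau)%R -> (2 * tau)%:E < m ->
  m * m <= \sum_(0 <= j <oo)
    (if (2 * (tau * 2 ^+ j))%:E < m then ((4 * (tau * 2 ^+ j)) ^+ 2)%:E else 0).
Proof.
move=> tau0 tm.
pose F j := if (2 * (tau * 2 ^+ j))%:E < m
  then ((4 * (tau * 2 ^+ j)) ^+ 2)%:E else 0.
have F0 j : 0 <= F j by rewrite /F; case: ifP => // _; rewrite lee_fin sqr_ge0.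
have Fsum j : F j <= \sum_(0 <= j <oo) F j.
  apply: (@le_trans _ _ (\sum_(0 <= i < j.+1) F i)); last exact: nneseries_lim_ge.
  by rewrite big_nat_recr//= leeDr// sume_ge0.
rewrite -[leRHS]/(\sum_(0 <= j <oo) F j).
case: m => [m| |] in tm F F0 Fsum *; last by [].
  have exk : exists k, (m <= 4 * (tau * 2 ^+ k))%R.
    have [k mk] := @pow2_unbounded (4 * tau) m (mulr_gt0 (ltr0n _ 4) tau0).
    by exists k; rewrite mulrA.
  have [k mk kmin] := ex_minnP exk.
  apply: le_trans (Fsum k); rewrite /F ifT.
    by rewrite lte_fin in tm; rewrite -EFinM lee_fin expr2 ler_pM//; lra.
  rewrite lte_fin in tm *; case: k mk kmin {exk} => [|k] mk kmin.
    by rewrite expr0 mulr1.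
  rewrite lte_fin ltNge; apply/negP => mk2.
  have /kmin : (m <= 4 * (tau * 2 ^+ k))%R     by move: mk2; rewrite exprS; lra.
  by rewrite ltnn.
(* For [m = +oo] every term is present and the terms are unbounded. *)
rewrite mulyy leye_eq; apply/eqP/eqyP => r r0.
have [k rk] := @pow2_unbounded (4 * tau) (r + 1)%R (mulr_gt0 (ltr0n _ 4) tau0).
apply: le_trans (Fsum k); rewrite /F ltry lee_fin mulrA.
nra.
Qed.


(** Marcinkiewicz interpolation with dyadic levels [t j] in place of the layer-cake integral. The
    weak bound turns [(4 * t j) ^+ 2] times the measure of a level set into [16 * K * t j] times the
    integral of [above (t j) f]. Summing over [j] under the integral gives a further factor
    [2 * |f|], whence [32 * K]. *)
Lemma weak_to_strong2 d (T : measurableType d) (mu : {measure set T -> \bar R})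
    (m f : T -> \bar R) (K : R) : (0 <= K)%R ->
  measurable_fun setT m -> (forall x, 0 <= m x) -> measurable_fun setT f ->
  (forall t : R, (0 < t)%R -> mu [set x | (2 * t)%:E < m x] <=
    (K / t)%:E * \int[mu]_x above t f x) ->
  \int[mu]_x (m x * m x) <= (32 * K)%:E * \int[mu]_x (`|f x| * `|f x|).
Proof.
move=> K0 mm m0 mf wt.
pose A (t : R) := [set x | (2 * t)%:E < m x].
have mA t : measurable (A t).
  rewrite -[X in measurable X]setTI; exact: emeasurable_fun_o_infty.
have mmm : measurable_fun setT (fun x => m x * m x) by exact: emeasurable_funM.
have mff : measurable_fun setT (fun x => `|f x| * `|f x|).
  by apply: emeasurable_funM; exact: measurableT_comp.
have mab t : measurable_fun setT (above t f) by exact: measurable_above.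
(* Dyadic levels need a positive lowest one, so the bound is first proved on the set where [m]
   exceeds [2 * tau], uniformly in [tau]. *)
have level (tau : R) : (0 < tau)%R -> \int[mu]_(x in A tau) (m x * m x) <=
    (32 * K)%:E * \int[mu]_x (`|f x| * `|f x|).
  move=> tau0; pose t j : R := (tau * 2 ^+ j)%R.
  have t0 j : (0 < t j)%R by rewrite mulr_gt0 ?exprn_gt0.
  pose F j x := ((4 * t j) ^+ 2)%:E * (\1_(A (t j)) x)%:E.
  have F0 j x : 0 <= F j x by rewrite mule_ge0 ?lee_fin// sqr_ge0.
  have mF j : measurable_fun setT (F j).
    by apply: measurable_funeM; apply/measurable_EFinP; exact: measurable_indic.
  pose G j x := (16 * K * t j)%:E * above (t j) f x.
  have c0 j : (0 <= 16 * K * t j)%R by rewrite !mulr_ge0// ltW.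
  have G0 j x : 0 <= G j x by rewrite mule_ge0 ?above_ge0 ?lee_fin.
  have mG j : measurable_fun setT (G j) by exact: measurable_funeM.
  apply: (@le_trans _ _ (\int[mu]_(x in A tau) \sum_(0 <= j <oo) F j x)).
    apply: ge0_le_integral => //.
    - by move=> x _; rewrite mule_ge0.
    - exact: measurable_funTS.
    - by apply: measurable_funTS; exact: ge0_emeasurable_sum.
    - move=> x /= tm; apply: (le_trans (sqr_le_dyadic tau0 tm)).
      rewrite le_eqVlt; apply/orP; left; apply/eqP.
      apply: eq_eseriesr => j _; rewrite /F indicE.
      have -> : (x \in A (t j)) = ((2 * t j)%:E < m x).
        by apply/idP/idP => [/set_mem|/mem_set].
      by rewrite -/(t j); case: ifP => _; rewrite ?mule1 ?mule0.
  rewrite integral_nneseries//; last by move=> j; exact: measurable_funTS.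
  apply: (@le_trans _ _ (\sum_(0 <= j <oo) \int[mu]_x G j x)).
    apply: lee_nneseries => [j _ _|j _]; first exact: integral_ge0.
    apply: (@le_trans _ _ (\int[mu]_x F j x)); first exact: ge0_subset_integral.
    rewrite /F ge0_integralZl//; [|
      by apply/measurable_EFinP; exact: measurable_indic|
      by rewrite lee_fin sqr_ge0].
    rewrite integral_indic// setIT /G ge0_integralZl//; [|
      by move=> x _; exact: above_ge0|by rewrite lee_fin].
    apply: (@le_trans _ _ (((4 * t j) ^+ 2)%:E *
        ((K / t j)%:E * \int[mu]_x above (t j) f x))).
      by apply: lee_wpmul2l; [rewrite lee_fin sqr_ge0|exact: wt].
    rewrite muleA -EFinM le_eqVlt; apply/orP; left; apply/eqP; congr (_%:E * _).
    by field; rewrite gt_eqF.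
  rewrite -(@integral_nneseries _ _ _ mu setT measurableT G)//.
  rewrite -ge0_integralZl ?lee_fin ?mulr_ge0//.
  apply: ge0_le_integral => //.
  - by move=> x _; exact: nneseries_ge0.
  - exact: ge0_emeasurable_sum.
  - exact: measurable_funeM.
  - move=> x _; apply: lime_le; first exact: is_cvg_nneseries.
    apply: nearW => J.
    set u := `|f x|.
    have K16 : 0 <= (16 * K)%:E by rewrite lee_fin mulr_ge0.
    apply: (@le_trans _ _ ((16 * K)%:E * u * (2%:E * u))); last first.
      rewrite muleACA -EFinM; rewrite le_eqVlt; apply/orP; left; apply/eqP.
      by congr (_%:E * _); ring.
    have u0 : 0 <= u by exact: abse_ge0.
    have K16u : 0 <= (16 * K)%:E * u by exact: mule_ge0.
    apply: le_trans (lee_wpmul2l K16u (@sum_dyadic_le tau u J tau0 u0)).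
    rewrite ge0_sume_distrr; last first.
      by move=> j _; case: ifP => // _; rewrite lee_fin; exact: ltW (t0 j).
    apply: lee_sum => j _; rewrite /G /above -/u -/(t j).
    by case: ifP => _; rewrite ?mule0// EFinM muleAC.
(* Letting [tau] run through [2 ^- N] exhausts the set where [m] is nonzero. *)
pose D N := A ((2 ^+ N)^-1)%R.
have ndD : nondecreasing_seq D.
  move=> j k jk; apply/subsetPset => y; rewrite /D /A /=.
  move=> Djy; apply: le_lt_trans Djy.
  by rewrite lee_fin ler_pM2l// lef_pV2 ?posrE ?exprn_gt0// ler_weXn2l// ler1n.
have DE : \int[mu]_x (m x * m x) = \int[mu]_(x in \bigcup_N D N) (m x * m x).
  rewrite [RHS]integral_mkcond; apply: eq_integral => x _; rewrite patchE.
  case: ifPn => // /negP xD; suff -> : m x = 0 by rewrite mule0.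
  apply/eqP; rewrite eq_le m0 andbT leNgt; apply/negP => mx0; apply: xD.
  apply/mem_set.
  have [r r0 rm] : exists2 r : R, (0 < r)%R & r%:E < m x.
    case: (m x) mx0 => [y|_|//]; last by exists 1%R; rewrite ?ltry.
    rewrite lte_fin => y0; exists (y / 2)%R; first lra.
    by rewrite lte_fin; lra.
  have [N Nr] := @pow2_unbounded r 2 r0.
  exists N => //; rewrite /D /A/=; apply: le_lt_trans rm.
  by rewrite lee_fin ler_pdivrMr ?exprn_gt0.
rewrite DE; apply: integral_bigcup_le => //.
- by move=> x; rewrite mule_ge0.
- by move=> N; exact: mA.
- by move=> N; apply: level; rewrite invr_gt0 exprn_gt0.
Qed.

End interpolation.

Lemma cube_maximal_strong2 (R : realType) n c (f : Rn R n -> \bar R) : 0 < c ->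
  measurable_fun setT f ->
  \int[leb R n]_x (cube_maximal c f x * cube_maximal c f x) <=
  (32 * 3 ^+ n)%:E * \int[leb R n]_x (`|f x| * `|f x|).
Proof.
move=> c0 mf; apply: weak_to_strong2.
- by rewrite exprn_ge0.
- exact: measurable_cube_maximal.
- by move=> x; exact: cube_maximal_ge0.
- exact: mf.
- by move=> t t0; exact: leb_cube_maximal_gt2.
Qed.

(** * The exponent *)

Section measurability.
Context d (T : measurableType d) (R : realType).

Lemma measurable_funV_gt0 (h : T -> R) : measurable_fun setT h ->
  (forall x, 0 < h x)%R -> measurable_fun setT (fun x => (h x)^-1)%R.
Proof.
move=> mh h0; rewrite (_ : (fun x => _) = (fun x => expR (- ln (h x)))).
  apply: measurableT_comp => //; apply: measurableT_comp => //.
  by apply: measurableT_comp => //; exact: measurable_ln.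
by apply/funext => x; rewrite expRN lnK// posrE.
Qed.

Lemma measurable_fun_poweR (f : T -> \bar R) (q : T -> R) :
  measurable_fun setT f -> measurable_fun setT q ->
  (forall x, 0 <= f x) -> (forall x, 0 < q x)%R ->
  measurable_fun setT (fun x => f x `^ q x).
Proof.
move=> mf mq f0 q0.
rewrite (_ : (fun x => _) = (fun x => if f x == +oo then +oo else
    if f x == 0 then 0 else (expR (q x * ln (fine (f x))))%:E)).
  apply: measurable_fun_ifT => //; first exact: measurable_fun_eqe.
  apply: measurable_fun_ifT => //; first exact: measurable_fun_eqe.
  apply/measurable_EFinP; apply: measurableT_comp => //.
  apply: measurable_funM => //.
  apply: measurableT_comp; first exact: measurable_ln.
  exact: measurableT_comp.
apply/funext => x; case: (f x) (f0 x) => [r| |]//= r0; last by rewrite gt_eqF.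
by rewrite /powR eqe; case: eqP => // _; rewrite gt_eqF.
Qed.

End measurability.

Section exponent.
Context {R : realType}.

Definition l1norm n (x : Rn R n) : R := (\sum_(i < n) `|tnth x i|)%R.

Definition cone_exponent n (x : Rn R n.+1) : R :=
  (3 + tnth x ord0 / (1 + l1norm x))%R.

Lemma l1norm_ge0 n (x : Rn R n) : (0 <= l1norm x)%R.
Proof. by apply: sumr_ge0. Qed.

Lemma ler_coord_l1norm n (x : Rn R n) i : (`|tnth x i| <= l1norm x)%R.
Proof. by rewrite /l1norm (bigD1 i)//= lerDl sumr_ge0. Qed.

Lemma measurable_l1norm n : measurable_fun setT (@l1norm n).
Proof.
apply: measurable_sum => i.
apply: measurableT_comp (measurable_coord i); exact: normr_measurable.
Qed.

Lemma measurable_cone_exponent n : measurable_fun setT (@cone_exponent n).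
Proof.
have m1 : measurable_fun setT (fun x : Rn R n.+1 => (1 + l1norm x)%R).
  by apply: measurable_funD; [exact: measurable_cst|exact: measurable_l1norm].
apply: measurable_funD; first exact: measurable_cst.
apply: measurable_funM; first exact: measurable_coord.
by apply: measurable_funV_gt0 => // x; rewrite ltr_pwDl// l1norm_ge0.
Qed.

Lemma cone_exponent_bounds n (x : Rn R n.+1) : (2 < cone_exponent x < 4)%R.
Proof.
have S0 := l1norm_ge0 x; have := ler_coord_l1norm x ord0.
rewrite ler_norml => /andP[x1 x2].
have S1 : (0 < 1 + l1norm x)%R by lra.
have : (-1 < tnth x ord0 / (1 + l1norm x) < 1)%R.
  by rewrite ltr_pdivlMr// ltr_pdivrMr//; apply/andP; split; lra.
by move=> /andP[? ?]; rewrite /cone_exponent; apply/andP; split; lra.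
Qed.

Lemma ler_dist_l1norm n (a : n.-tuple R) l (x y : Rn R n) :
  cube a l x -> cube a l y -> (`|l1norm x - l1norm y| <= n%:R * l)%R.
Proof.
move=> xa ya; rewrite /l1norm -sumrB.
apply: le_trans (ler_norm_sum _ _ _) _.
have -> : (n%:R * l = \sum_(i < n) l)%R by rewrite sumr_const card_ord mulr_natl.
apply: ler_sum => i _; apply: le_trans (ler_dist_dist _ _) _.
have /andP[? ?] := xa i; have /andP[? ?] := ya i.
by rewrite ler_norml; apply/andP; split; lra.
Qed.

(** With [h y = y_0 / (1 + |y|_1)], the difference times [1 + |x|_1] equals
    [(y_0 - x_0) + h y * (|x|_1 - |y|_1)]. The first term is at most [l], the second at most
    [n.+1 * l] because [|h y| <= 1]. *)
Lemma cone_exponent_osc n (a : n.+1.-tuple R) l (x y : Rn R n.+1) :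
  cube a l x -> cube a l y ->
  (`|cone_exponent y - cone_exponent x| * (1 + l1norm x) <= n.+2%:R * l)%R.
Proof.
move=> xa ya; have Sx0 := l1norm_ge0 x; have Sy0 := l1norm_ge0 y.
have Sxy := ler_dist_l1norm xa ya.
set Sx := l1norm x in Sx0 Sxy *; set Sy := l1norm y in Sy0 Sxy *.
have Sx1 : (0 < 1 + Sx)%R by lra.
have Sy1 : (0 < 1 + Sy)%R by lra.
rewrite -[X in (_ * X)%R](gtr0_norm Sx1) -normrM.
have -> : ((cone_exponent y - cone_exponent x) * (1 + Sx) =
    (tnth y ord0 - tnth x ord0) + tnth y ord0 / (1 + Sy) * (Sx - Sy))%R.
  rewrite /cone_exponent -/Sx -/Sy; field; rewrite !gt_eqF//.
apply: le_trans (ler_normD _ _) _.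
rewrite -natr1 mulrDl mul1r [leRHS]addrC; apply: lerD.
  have /andP[? ?] := xa ord0; have /andP[? ?] := ya ord0.
  by rewrite ler_norml; apply/andP; split; lra.
rewrite normrM -[leRHS]mul1r ler_pM//.
rewrite normrM normfV (gtr0_norm Sy1) ler_pdivrMr// mul1r.
by apply: le_trans (ler_coord_l1norm y ord0) _; rewrite -/Sy lerDr.
Qed.

(** After taking logarithms, the right side minus the left is [(py / 2 - 1) * (ln w - ln b)] plus
    [k + (py - px) / 2 * ln b]; both are nonnegative. This trades the exponent at [y] for the one at
    [x] where [|f y|] exceeds [b]. *)
Lemma ler_powR_exchange (w b px py k : R) : (0 < b <= w)%R -> (2 <= py)%R ->
  (`|py - px| * `|ln b| <= 2 * k)%R ->
  (w <= expR k * b `^ (1 - px / 2) * w `^ (py / 2))%R.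
Proof.
move=> /andP[b0 bw] py2 h; have w0 : (0 < w)%R by exact: lt_le_trans bw.
rewrite /powR !gt_eqF// -!expRD -{1}(lnK w0) ler_expR.
have lbw : (ln b <= ln w)%R by rewrite ler_ln.
have : ((px - py) * ln b <= 2 * k)%R.
  by apply: le_trans h; rewrite distrC -normrM ler_norm.
nra.
Qed.

End exponent.

(** * The integrable weight *)

Lemma ge0_integral_le_affine d (T : measurableType d) (R : realType)
    (mu : {measure set T -> \bar R}) (A : set T) (f g : T -> \bar R) (b k v : R) :
  measurable A -> mu A = v%:E -> measurable_fun setT f -> measurable_fun setT g ->
  (forall x, 0 <= f x) -> (forall x, 0 <= g x) -> (0 <= b)%R -> (0 <= k)%R ->
  (forall x, A x -> f x <= b%:E + k%:E * g x) ->
  \int[mu]_(x in A) f x <= (b * v)%:E + k%:E * \int[mu]_(x in A) g x.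
Proof.
move=> mA muA mf mg f0 g0 b0 k0 fg.
have mkg : measurable_fun A (fun x => k%:E * g x).
  by apply: measurable_funTS; exact: measurable_funeM.
have mgA : measurable_fun A g by exact: measurable_funTS.
have kg0 x : 0 <= k%:E * g x by rewrite mule_ge0// lee_fin.
rewrite EFinM -muA -integral_cst// -ge0_integralZl ?lee_fin// -ge0_integralD//.
apply: ge0_le_integral => //; first exact: measurable_funTS.
exact: emeasurable_funD.
Qed.

Lemma ge0_le_poweR (R : realType) (p : R) (x y : \bar R) :
  (0 <= p)%R -> 0 <= x -> x <= y -> x `^ p <= y `^ p.
Proof.
move=> p0 x0 xy; have y0 := le_trans x0 xy.
by apply: gt0_ler_poweR => //; rewrite in_itv/= leey andbT.
Qed.

(** Taking [p]-th roots shows that the power of a maximal function can be estimated one cube at a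
    time. *)
Lemma poweR_ereal_sup_le (R : realType) (S : set (\bar R)) (p : R) (E : \bar R) :
  (0 < p)%R -> 0 <= ereal_sup S -> 0 <= E ->
  (forall z, S z -> 0 <= z /\ z `^ p <= E) -> ereal_sup S `^ p <= E.
Proof.
move=> p0 S0 E0 SE.
have Ep : (E `^ p^-1) `^ p = E by rewrite -poweRrM mulVf ?gt_eqF// poweRe1.
rewrite -Ep; apply: ge0_le_poweR => //; first exact: ltW.
apply: ge_ereal_sup => z /SE[z0 zE].
have -> : z = (z `^ p) `^ p^-1 by rewrite -poweRrM mulfV ?gt_eqF// poweRe1.
by apply: ge0_le_poweR; rewrite ?poweR_ge0// invr_ge0 ltW.
Qed.

Section weight.
Context {R : realType} {n : nat}.

(** The rate [n.+1] exceeds the dimension by one: part of the decay pays for the volume of large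
    cubes, the rest makes the sum converge. *)
Definition weight (x : Rn R n) : R := expR (- (n.+1%:R * (1 + l1norm x))).

Lemma weight_gt0 x : (0 < weight x)%R. Proof. exact: expR_gt0. Qed.

Lemma weight_le1 x : (weight x <= 1)%R.
Proof. by rewrite expR_le1 oppr_le0 mulr_ge0// addr_ge0// l1norm_ge0. Qed.

Lemma measurable_weight : measurable_fun setT weight.
Proof.
apply: measurableT_comp; first exact: measurable_expR.
apply: measurableT_comp; first exact: oppr_measurable.
apply: measurable_funM; first exact: measurable_cst.
by apply: measurable_funD; [exact: measurable_cst|exact: measurable_l1norm].
Qed.

Lemma exp2_le_expR k : ((2 ^ k)%:R <= expR (k%:R : R))%R.
Proof.
elim: k => [|k IH]; first by rewrite expn0 expR0.
rewrite expnS natrM -[k.+1%:R]natr1 expRD mulrC ler_pM//.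
by apply: le_trans (expR_ge1Dx 1); lra.
Qed.

(** Where [k <= |x|_1 < k.+1] the weight is at most [w k] and [x] lies in [Q k]. The products of
    [w k] with the volume of [Q k] are at most [2 ^- k.+1], whose sum is [1]. *)
Lemma integral_weight : \int[leb R n]_x (weight x)%:E <= 1.
Proof.
pose Q k : set (Rn R n) := cube [tuple (- k.+1%:R)%R | i < n] (2 * k.+1%:R)%R.
pose w k : R := expR (- (n.+1%:R * k.+1%:R)).
have w0 k : (0 <= w k)%R by exact: expR_ge0.
have mQ k : measurable (Q k) by exact: measurable_cube.
have mwQ k : measurable_fun setT (fun x => (w k)%:E * (\1_(Q k) x)%:E).
  by apply: measurable_funeM; apply/measurable_EFinP; exact: measurable_indic.
apply: (@le_trans _ _
    (\int[leb R n]_x \sum_(0 <= k <oo) (w k)%:E * (\1_(Q k) x)%:E)).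
  apply: ge0_le_integral.
  - exact: measurableT.
  - by move=> x _; rewrite lee_fin ltW// weight_gt0.
  - by apply/measurable_EFinP; exact: measurable_weight.
  - by apply: ge0_emeasurable_sum => // k x _ _; rewrite mule_ge0 ?lee_fin.
  move=> x _; have S0 := l1norm_ge0 x; set k := Num.trunc (l1norm x).
  have [kS Sk] : (k%:R <= l1norm x)%R /\ (l1norm x < k.+1%:R)%R.
    by have /andP[] := truncn_itv S0.
  apply: (@le_trans _ _ (\sum_(0 <= i < k.+1) (w i)%:E * (\1_(Q i) x)%:E));
    last first.
    by apply: nneseries_lim_ge => i _ _; rewrite mule_ge0 ?lee_fin.
  rewrite big_nat_recr//=.
  apply: (@le_trans _ _ ((w k)%:E * (\1_(Q k) x)%:E)); last first.
    by rewrite leeDr// sume_ge0// => i _; rewrite mule_ge0 ?lee_fin.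
  rewrite indicE mem_set ?mule1.
    by rewrite lee_fin ler_expR lerN2 ler_pM2l// -natr1 addrC lerD2l.
  move=> i; rewrite tnth_mktuple; have := ler_coord_l1norm x i.
  by rewrite ler_norml => /andP[? ?]; apply/andP; split; lra.
rewrite integral_nneseries//; last by move=> k x _; rewrite mule_ge0 ?lee_fin.
apply: le_trans (epsilon_trick0 xpredT (@ler01 R)).
apply: lee_nneseries => [k _ _|k _].
  by apply: integral_ge0 => x _; rewrite mule_ge0 ?lee_fin.
rewrite ge0_integralZl; [|exact: measurableT|
  by apply/measurable_EFinP; exact: measurable_indic|
  by move=> x _; rewrite lee_fin|by rewrite lee_fin].
rewrite integral_indic// setIT leb_cube// -EFinM lee_fin div1r.
have z0 : (0 < k.+1%:R :> R)%R by [].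
have z2 : (2 * k.+1%:R <= expR (k.+1%:R : R))%R.
  apply: le_trans (exp2_le_expR k.+1).
  by rewrite -natrM ler_nat expnS leq_mul2l/= ltn_expl.
apply: (@le_trans _ _ (w k * expR (n%:R * k.+1%:R))%R).
  apply: ler_wpM2l; first exact: w0.
  rewrite expRM_natl; apply: lerXn2r; rewrite ?nnegrE ?expR_ge0//.
rewrite -expRD (_ : (_ + _ = - k.+1%:R)%R); last by rewrite -[n.+1%:R]natr1; ring.
by rewrite expRN lef_pV2 ?posrE ?expR_gt0 ?ltr0n ?expn_gt0//; exact: exp2_le_expR.
Qed.

End weight.

(** * Pointwise bound for averages over small cubes *)

Section local_average.
Context {R : realType} {n : nat}.
Local Notation p := (@cone_exponent R n).

Definition half_power (f : Rn R n.+1 -> \bar R) y := `|f y| `^ (p y / 2).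

Lemma half_power_ge0 f y : 0 <= half_power f y.
Proof. exact: poweR_ge0. Qed.

Lemma cone_exponent_gt0 x : (0 < p x)%R.
Proof. by have /andP[? ?] := cone_exponent_bounds x; lra. Qed.

Lemma measurable_half_power f : measurable_fun setT f ->
  measurable_fun setT (half_power f).
Proof.
move=> mf; apply: measurable_fun_poweR.
- exact: measurableT_comp.
- by apply: measurable_funM; [exact: measurable_cone_exponent|exact: measurable_cst].
- by move=> x; exact: abse_ge0.
- by move=> x; rewrite divr_gt0// cone_exponent_gt0.
Qed.

Lemma half_power_sqr f y : half_power f y * half_power f y = `|f y| `^ p y.
Proof.
rewrite /half_power -poweRD.
  by congr (_ `^ _); field.
apply: add_neq0_poweRD_def; have := cone_exponent_gt0 y.
by move=> ?; rewrite gt_eqF//; lra.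
Qed.

(** This is [expR k] of [ler_powR_exchange] for the value of [k] supplied by [ler_osc_ln]. *)
Definition osc_const : R := expR (n.+2%:R ^+ 2).

(* The two logarithmic estimates: [b <= l ^- n.+1] pays for the oscillation of
   [p] at small scales, [weight x < b] for its decay at infinity. *)
Lemma ler_osc_ln a l (x y : Rn R n.+1) (b : R) : (0 < l <= 1)%R ->
  cube a l x -> cube a l y -> (weight x < b)%R -> (b <= (l ^+ n.+1)^-1)%R ->
  (`|p y - p x| * `|ln b| <= 2 * n.+2%:R ^+ 2)%R.
Proof.
move=> /andP[l0 l1] xa ya wb bl; have b0 := lt_trans (weight_gt0 x) wb.
have := cone_exponent_osc xa ya.
have T1 : (1 <= 1 + l1norm x)%R by rewrite lerDl l1norm_ge0.
set T := (1 + l1norm x)%R in T1 *; set D := `|p y - p x|%R => DT.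
have D0 : (0 <= D)%R by exact: normr_ge0.
have lnlb : (- (n.+2%:R * T) <= ln b)%R.
  by rewrite -[leLHS]expRK ler_ln ?posrE ?expR_gt0// ltW.
have lnub : (ln b * l <= n.+1%:R)%R.
  have : (ln b <= ln ((l ^+ n.+1)^-1))%R.
    by rewrite ler_ln ?posrE ?invr_gt0 ?exprn_gt0.
  rewrite -exprVn lnXn ?invr_gt0// => lnb.
  have lnl : (ln l^-1 * l <= 1)%R.
    by rewrite -ler_pdivlMr// div1r ltW// ln_sublinear// invr_gt0.
  apply: (@le_trans _ _ ((ln l^-1 *+ n.+1) * l)%R); first by rewrite ler_pM2r.
  by rewrite mulrnAl lerMn2r lnl orbT.
have n12 : (n.+1%:R <= n.+2%:R :> R)%R by rewrite ler_nat.
have n0 : (0 <= n.+1%:R :> R)%R by [].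
(* For [ln b >= 0] the bound [D <= n.+2 * l] absorbs [ln b <= n.+1 / l]; for [ln b < 0] the factor
   [T] in [|ln b| <= n.+2 * T] is absorbed by [D * T <= n.+2 * l]. *)
have [lb0|lb0] := leP 0%R (ln b).
  rewrite ger0_norm//.
  have Dl : (D <= n.+2%:R * l)%R by nra.
  apply: (@le_trans _ _ (n.+2%:R * l * ln b)%R); first by rewrite ler_wpM2r.
  by rewrite -mulrA [(l * _)%R]mulrC; nra.
rewrite ltr0_norm//.
apply: (@le_trans _ _ (D * (n.+2%:R * T))%R); first by rewrite ler_wpM2l// lerNl.
by rewrite mulrCA; nra.
Qed.

(** Let [b] be half the average. The points with [|f| <= b] carry at most half of the integral; on
    the others [|f|] is exchanged for [half_power f]. This yields
    [b <= osc_const * b ^ (1 - p x / 2) * m], that is [b ^ (p x / 2) <= osc_const * m], to be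
    squared. *)
Lemma poweR_average_le (f : Rn R n.+1 -> \bar R) a l x :
  measurable_fun setT f -> modular p f <= 1 -> (0 < l < 1)%R -> cube a l x ->
  average f (cube a l) `^ p x <= (16 * weight x)%:E +
    (16 * osc_const ^+ 2)%:E *
      (cube_maximal 1 (half_power f) x * cube_maximal 1 (half_power f) x).
Proof.
move=> mf f1 /andP[l0 l1] xa.
set m := cube_maximal 1 (half_power f) x.
have m0 : 0 <= m by exact: cube_maximal_ge0.
set V := (l ^+ n.+1)%R; have V0 : (0 < V)%R by rewrite exprn_gt0.
have V1 : (V <= 1)%R by rewrite exprn_ile1// ltW.
have muQ : leb R n.+1 (cube a l) = V%:E by rewrite leb_cube.
have mQ := measurable_cube a l.
have maf : measurable_fun setT (fun y => `|f y|) by exact: measurableT_comp.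
have mG := measurable_half_power mf.
have mpf : measurable_fun setT (fun y => `|f y| `^ p y).
  apply: measurable_fun_poweR; [exact: maf|exact: measurable_cone_exponent|
    by move=> y; exact: abse_ge0|exact: cone_exponent_gt0].
have /andP[p2 p4] := cone_exponent_bounds x.
(* The integral is at most [2] because [|f| <= 1 + |f|^p], the cube has volume at most [1] and the
   modular is at most [1]. *)
have [r r0 [r2 rE]] : exists2 r : R, (0 <= r)%R &
    (r <= 2)%R /\ \int[leb R n.+1]_(y in cube a l) `|f y| = r%:E.
  have I0 : 0 <= \int[leb R n.+1]_(y in cube a l) `|f y| by exact: integral_ge0.
  have I2 : \int[leb R n.+1]_(y in cube a l) `|f y| <= 2%:E.
    apply: le_trans (ge0_integral_le_affine mQ muQ maf mpf _ _ ler01 ler01 _) _.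
    - by move=> y; exact: abse_ge0.
    - by move=> y; exact: poweR_ge0.
    - move=> y _; rewrite mul1e.
      case: `|f y| (abse_ge0 (f y)) => [w| |]//=; last first.
        by rewrite gt_eqF ?cone_exponent_gt0// addey.
      rewrite !lee_fin => w0; have := powR_ge0 w (p y).
      have /andP[q2 _] := cone_exponent_bounds y.
      have [w1|w1] := leP w 1%R; first by lra.
      by have := @le1r_powR R w (p y) (ltW w1); lra.
    rewrite mul1r mul1e (_ : 2%:E = 1%:E + 1) ?EFinD//.
    apply: leeD; first by rewrite lee_fin.
    apply: le_trans f1; apply: ge0_subset_integral;
      [exact: mQ|exact: measurableT|exact: mpf| |by []].
    by move=> y _; exact: poweR_ge0.
  case: (integral _ _ _) I0 I2 => [r| |]//; rewrite !lee_fin => r0 r2.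
  by exists r.
(* Halving serves twice: [r <= 2] gives [b <= V^-1], and the part of the integral below height [b]
   can be subtracted from [r = 2 * b * V]. *)
pose b := (r / (2 * V))%R.
have rb : r = (2 * b * V)%R by rewrite /b; field; rewrite gt_eqF.
have b0 : (0 <= b)%R by rewrite /b divr_ge0// mulr_ge0// ltW.
have bV : (b <= V^-1)%R.
  by rewrite /b ler_pdivrMr ?mulr_gt0// mulrCA mulVf ?gt_eqF// mulr1.
have avgE : average f (cube a l) = (2 * b)%:E.
  by rewrite average_cube// -/V rE rb -EFinM; congr (_%:E); field; rewrite gt_eqF.
rewrite avgE poweR_EFin powRM//.
have two16 : (2 `^ p x <= 16 :> R)%R.
  apply: (@le_trans _ _ (2 `^ 4%:R)%R); last by rewrite powR_mulrn//; lra.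
  by apply: ler_powR; lra.
have K0 : (0 < osc_const)%R by exact: expR_gt0.
(* Below the weight no comparison with [m] is available, but [weight x <= 1] and [p x >= 1] give
   [b ^ p x <= weight x]. *)
have [bw|bw] := leP b (weight x).
  apply: (@le_trans _ _ (16 * weight x)%:E); last first.
    rewrite leeDl//; apply: mule_ge0; last exact: mule_ge0.
    by rewrite lee_fin mulr_ge0// sqr_ge0.
  rewrite lee_fin ler_pM ?powR_ge0//.
  apply: (@le_trans _ _ (weight x `^ p x)%R).
    by apply: ge0_ler_powR; rewrite ?nnegrE ?(ltW (weight_gt0 x))//; lra.
  by apply: ge1r_powR; rewrite ?weight_gt0 ?weight_le1//; lra.
have {}b0 : (0 < b)%R := lt_trans (weight_gt0 x) bw.
apply: (@le_trans _ _ ((16 * osc_const ^+ 2)%:E * (m * m))); last first.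
  by rewrite leeDr// lee_fin mulr_ge0// ltW// weight_gt0.
case mE : m m0 => [u| |]// u0; last first.
  by rewrite mulyy gt0_muley ?leey// lte_fin mulr_gt0// exprn_gt0.
rewrite lee_fin in u0; pose k := (osc_const * b `^ (1 - p x / 2))%R.
have k0 : (0 <= k)%R by rewrite /k mulr_ge0 ?powR_ge0 ?ltW.
have Gu : \int[leb R n.+1]_(y in cube a l) half_power f y <= (V * u)%:E.
  have : average (half_power f) (cube a l) <= m.
    apply: ereal_sup_ubound; exists (cube a l) => //.
    by exists a, l.
  rewrite average_cube// mE lee_pdivrMl// -EFinM.
  by under eq_integral do rewrite gee0_abs ?half_power_ge0//.
have : r%:E <= (b * V)%:E + k%:E * (V * u)%:E.
  rewrite -rE.
  apply: le_trans (ge0_integral_le_affine mQ muQ maf mG _ _ (ltW b0) k0 _) _.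
  - by move=> y; exact: abse_ge0.
  - by move=> y; exact: half_power_ge0.
  - move=> y ya; rewrite /half_power.
    have /andP[q2 _] := cone_exponent_bounds y.
    case: `|f y| (abse_ge0 (f y)) => [w| |]//=; last first.
      rewrite gt_eqF ?divr_gt0 ?cone_exponent_gt0// gt0_muley ?lte_fin ?addey//.
      by rewrite /k mulr_gt0// powR_gt0.
    rewrite !lee_fin => w0; have [wb|bw'] := leP w b.
      by rewrite ler_wpDr// mulr_ge0// powR_ge0.
    rewrite ler_wpDl ?(ltW b0)//.
    apply: ler_powR_exchange; [by rewrite b0 ltW|exact: ltW|].
    by apply: ler_osc_ln xa ya bw bV; rewrite l0 ltW.
  - by apply: leeD2l; apply: lee_wpmul2l; rewrite ?lee_fin.
rewrite -EFinM -EFinD lee_fin rb => h.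
have bku : (b <= k * u)%R.
  by rewrite -(ler_pM2r V0); nra.
have hp : (b `^ (p x / 2) <= osc_const * u)%R.
  rewrite -(@ler_pM2l _ (b `^ (1 - p x / 2))) ?powR_gt0//.
  have -> : (b `^ (1 - p x / 2) * b `^ (p x / 2) = b)%R.
    rewrite -powRD; last by rewrite (gt_eqF b0) implybT.
    by rewrite subrK; apply: powRr1; exact: ltW.
  by rewrite mulrA [(_ * osc_const)%R]mulrC.
have -> : (b `^ p x = b `^ (p x / 2) * b `^ (p x / 2))%R.
  rewrite -powRD; last by rewrite (gt_eqF b0) implybT.
  by congr (_ `^ _)%R; field.
rewrite -!EFinM lee_fin -mulrA ler_pM ?powR_ge0 ?mulr_ge0 ?powR_ge0//.
rewrite expr2 (_ : osc_const * osc_const * (u * u) =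
  (osc_const * u) * (osc_const * u))%R; last by ring.
by rewrite ler_pM ?powR_ge0.
Qed.
End local_average.

(** * Boundedness of the local maximal operator *)

Section scaling.
Context {R : realType} {n : nat}.
Implicit Types (p : Rn R n -> R) (f g : Rn R n -> \bar R).

Lemma abse_divr (x : \bar R) (r : R) : (0 < r)%R ->
  `|x / r%:E| = (r^-1)%:E * `|x|.
Proof.
by move=> r0; rewrite inver gt_eqF// abseM abse_EFin gtr0_norm ?invr_gt0// muleC.
Qed.

Lemma measurable_modular p f : measurable_fun setT p -> (forall x, 0 < p x)%R ->
  measurable_fun setT f -> measurable_fun setT (fun x => `|f x| `^ p x).
Proof.
move=> mp p0 mf; apply: measurable_fun_poweR; [|exact: mp| |exact: p0].
  exact: measurableT_comp.
by move=> x; exact: abse_ge0.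
Qed.

Lemma le_modular p f g : measurable_fun setT p -> (forall x, 0 < p x)%R ->
  measurable_fun setT f -> measurable_fun setT g ->
  (forall x, `|f x| <= `|g x|) -> modular p f <= modular p g.
Proof.
move=> mp p0 mf mg fg; apply: ge0_le_integral.
- exact: measurableT.
- by move=> x _; exact: poweR_ge0.
- exact: measurable_modular.
- exact: measurable_modular.
- by move=> x _; apply: ge0_le_poweR => //; exact: ltW.
Qed.

Lemma measurable_div f (r : R) : measurable_fun setT f ->
  measurable_fun setT (fun x => f x / r%:E).
Proof.
move=> mf; rewrite (_ : (fun x => _) = (fun x => (r%:E)^-1 * f x)).
  exact: measurable_funeM.
by apply/funext => x; rewrite muleC.
Qed.

(** Since [p >= 1] and [s >= 1], the factor [s ^ - p x] is at most [s^-1] at every point. *)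
Lemma modular_scale p f (s r : R) : measurable_fun setT p ->
  (forall x, 1 <= p x)%R -> measurable_fun setT f -> (1 <= s)%R -> (0 < r)%R ->
  modular p (fun x => f x / (s * r)%:E) <=
  (s^-1)%:E * modular p (fun x => f x / r%:E).
Proof.
move=> mp p1 mf s1 r0; have s0 : (0 < s)%R by exact: lt_le_trans s1.
have p0 x : (0 < p x)%R by exact: lt_le_trans (p1 x).
have mfr := measurable_modular mp p0 (measurable_div r mf).
have mfsr := measurable_modular mp p0 (measurable_div (s * r) mf).
rewrite /modular -ge0_integralZl; [|exact: measurableT|exact: mfr|
  by move=> x _; exact: poweR_ge0|by rewrite lee_fin invr_ge0 ltW].
apply: ge0_le_integral.
- exact: measurableT.
- by move=> x _; exact: poweR_ge0.
- exact: mfsr.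
- exact: measurable_funeM.
move=> x _; rewrite !abse_divr ?mulr_gt0// invfM EFinM -muleA.
have rf0 : 0 <= (r^-1)%:E * `|f x| by rewrite mule_ge0// lee_fin invr_ge0 ltW.
rewrite (@poweRM _ (s^-1)%:E)//; last by rewrite lee_fin invr_ge0 ltW.
apply: lee_wpmul2r; first exact: poweR_ge0.
rewrite poweR_EFin lee_fin.
by apply: ge1r_powR => //; rewrite invr_gt0 s0 invf_le1.
Qed.

Lemma Lvar_normalize p f : measurable_fun setT p -> (forall x, 1 <= p x)%R ->
  Lvar p f -> exists2 r : R, (0 < r)%R & modular p (fun x => f x / r%:E) <= 1.
Proof.
move=> mp p1 [mf [r r0 rfin]].
have m0 : 0 <= modular p (fun x => f x / r%:E).
  by apply: integral_ge0 => x _; exact: poweR_ge0.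
have mE : modular p (fun x => f x / r%:E) \is a fin_num by rewrite ge0_fin_numE.
set M := fine (modular p (fun x => f x / r%:E)).
pose s := Num.max 1%R M; have s1 : (1 <= s)%R by rewrite le_max lexx.
have s0 : (0 < s)%R by exact: lt_le_trans s1.
exists (s * r)%R; first by rewrite mulr_gt0.
apply: le_trans (modular_scale mp p1 mf s1 r0) _.
by rewrite -(fineK mE) -EFinM lee_fin mulrC ler_pdivrMr// mul1r le_max lexx orbT.
Qed.

(** By [modular_scale], a modular bounded by [C] drops to at most [1] after a further division by
    [C]. So each [r] admissible in the norm of [f] makes [C * r] admissible for [T f]. *)
Lemma bounded_on_LvarI p (T : (Rn R n -> \bar R) -> Rn R n -> \bar R) (C : R) :
  measurable_fun setT p -> (forall x, 1 <= p x)%R -> (1 <= C)%R ->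
  (forall f, measurable_fun setT f -> measurable_fun setT (T f)) ->
  (forall f (r : R), measurable_fun setT f -> (0 < r)%R ->
    modular p (fun x => f x / r%:E) <= 1 ->
    modular p (fun x => T f x / r%:E) <= C%:E) ->
  bounded_on_Lvar p T.
Proof.
move=> mp p1 C1 mT TC; exists C => f fL.
have C0 : (0 < C)%R by exact: lt_le_trans C1.
have mf : measurable_fun setT f by case: fL.
have key (r : R) : (0 < r)%R -> modular p (fun x => f x / r%:E) <= 1 ->
    modular p (fun x => T f x / (C * r)%:E) <= 1.
  move=> r0 fr; apply: le_trans (modular_scale mp p1 (mT _ mf) C1 r0) _.
  by rewrite lee_pdivrMl// mule1; exact: TC.
have [r r0 fr] := Lvar_normalize mp p1 fL.
split.
  split; first exact: mT.
  exists (C * r)%R; first by rewrite mulr_gt0.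
  by rewrite (le_lt_trans (key _ r0 fr))// ltry.
rewrite -lee_pdivrMl//; apply: le_ereal_inf_tmp => _ [s [s0 fs] <-].
rewrite lee_pdivrMl//; apply: ereal_inf_lbound; exists (C * s)%R => //.
by split; [rewrite mulr_gt0|exact: key].
Qed.

Lemma cube_maximal_scale c f (r : R) x : measurable_fun setT f -> (0 < r)%R ->
  cube_maximal c f x <= r%:E * cube_maximal c (fun y => f y / r%:E) x.
Proof.
move=> mf r0; apply: ge_ereal_sup => _ [_ [a [l [l0 lc] [-> xa]]] <-].
rewrite (_ : average f (cube a l) = r%:E * average (fun y => f y / r%:E) (cube a l)).
  apply: lee_wpmul2l; first by rewrite lee_fin ltW.
  apply: ereal_sup_ubound; exists (cube a l) => //.
  by exists a, l.
rewrite !average_cube// muleCA; congr (_ * _).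
rewrite -ge0_integralZl; [|exact: measurable_cube| | |by rewrite lee_fin ltW].
- apply: eq_integral => y _.
  by rewrite abse_divr// muleA -EFinM divff ?gt_eqF// mul1e.
- apply: measurable_funTS; apply: measurableT_comp; first exact: abse_measurable.
  exact: measurable_div.
- by move=> y _; exact: abse_ge0.
Qed.

End scaling.

Section local_bound.
Context {R : realType} {n : nat}.
Local Notation p := (@cone_exponent R n).

Definition local_const : R :=
  (16 + 16 * @osc_const R n ^+ 2 * (32 * 3 ^+ n.+1))%R.

Lemma local_const_ge1 : (1 <= local_const)%R.
Proof.
have : (0 <= 16 * @osc_const R n ^+ 2 * (32 * 3 ^+ n.+1) :> R)%R.
  by apply: mulr_ge0; rewrite mulr_ge0// ?sqr_ge0// exprn_ge0.
by rewrite /local_const; lra.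
Qed.

(** Integrating the pointwise bound leaves the weight, of integral at most [1], and the square of a
    maximal function, controlled by the [L^2] bound; the square of [half_power f] integrates to the
    modular of [f]. *)
Lemma modular_cube_maximal (f : Rn R n.+1 -> \bar R) :
  measurable_fun setT f -> modular p f <= 1 ->
  modular p (cube_maximal 1 f) <= local_const%:E.
Proof.
move=> mf f1.
set m := cube_maximal 1 (half_power f).
have mG := measurable_half_power mf.
have mm : measurable_fun setT m by exact: measurable_cube_maximal.
have m0 x : 0 <= m x by exact: cube_maximal_ge0.
have mmm : measurable_fun setT (fun x => m x * m x) by exact: emeasurable_funM.
have mw : measurable_fun setT (fun x => (@weight R n.+1 x)%:E).
  by apply/measurable_EFinP; exact: measurable_weight.
set A := 16%R : R; set B := (16 * @osc_const R n ^+ 2)%R : R.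
have B0 : (0 <= B)%R by rewrite mulr_ge0// sqr_ge0.
apply: (@le_trans _ _
    (\int[leb R n.+1]_x (A%:E * (weight x)%:E + B%:E * (m x * m x)))).
  apply: ge0_le_integral.
  - exact: measurableT.
  - by move=> x _; exact: poweR_ge0.
  - apply: measurable_modular; [exact: measurable_cone_exponent|
      exact: cone_exponent_gt0|].
    exact: measurable_cube_maximal.
  - by apply: emeasurable_funD; exact: measurable_funeM.
  move=> x _; rewrite gee0_abs ?cube_maximal_ge0//.
  apply: poweR_ereal_sup_le.
  - exact: cone_exponent_gt0.
  - exact: cube_maximal_ge0.
  - apply: adde_ge0; apply: mule_ge0; rewrite ?lee_fin//; last exact: mule_ge0.
    by rewrite ltW// weight_gt0.
  move=> _ [_ [a [l [l0 l1] [-> xa]]] <-]; split.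
    rewrite average_cube// mule_ge0 ?integral_ge0//.
    by rewrite lee_fin invr_ge0 exprn_ge0// ltW.
  rewrite -EFinM; apply: poweR_average_le => //.
  by rewrite l0.
rewrite ge0_integralD; [|exact: measurableT| | | |]; first last.
- exact: measurable_funeM.
- by move=> x _; rewrite mule_ge0 ?lee_fin// mule_ge0.
- exact: measurable_funeM.
- by move=> x _; rewrite mule_ge0 ?lee_fin// ltW// weight_gt0.
rewrite ge0_integralZl; [|exact: measurableT|exact: mw| |by rewrite lee_fin];
  last first.
  by move=> x _; rewrite lee_fin ltW// weight_gt0.
rewrite ge0_integralZl; [|exact: measurableT|exact: mmm| |by rewrite lee_fin];
  last first.
  by move=> x _; rewrite mule_ge0.
have -> : local_const%:E = A%:E + B%:E * (32 * 3 ^+ n.+1)%:E by [].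
apply: leeD.
  rewrite -[leRHS]mule1; apply: lee_wpmul2l; first by rewrite lee_fin.
  exact: integral_weight.
apply: lee_wpmul2l; first by rewrite lee_fin.
apply: le_trans (cube_maximal_strong2 _ mG) _; first exact: lte01.
rewrite -[leRHS]mule1; apply: lee_wpmul2l.
  by rewrite lee_fin mulr_ge0// exprn_ge0.
apply: le_trans f1; rewrite le_eqVlt; apply/orP; left; apply/eqP.
by apply: eq_integral => x _; rewrite gee0_abs ?half_power_ge0// half_power_sqr.
Qed.

Lemma exponent_cone_exponent : exponent p.
Proof.
have p24 x : (2 <= p x <= 4)%R.
  by have /andP[? ?] := cone_exponent_bounds x; rewrite !ltW.
have p0 : range (EFin \o p) (p point)%:E by exists point.
split.
- exact: measurable_cone_exponent.
- by move=> x; have /andP[? ?] := p24 x; lra.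
- apply: (@lt_le_trans _ _ 2%:E); first by rewrite lte_fin; lra.
  apply: le_ereal_inf_tmp => _ [x _ <-] /=.
  by rewrite lee_fin; have /andP[] := p24 x.
- by apply: (@le_trans _ _ (p point)%:E); [exact: ereal_inf_lbound|
    exact: ereal_sup_ubound].
- apply: (@le_lt_trans _ _ 4%:E); last exact: ltry.
  by apply: ge_ereal_sup => _ [x _ <-] /=; rewrite lee_fin; have /andP[] := p24 x.
Qed.

Lemma cone_exponent_calBloc : calBloc R n.+1 p.
Proof.
split; first exact: exponent_cone_exponent.
have [mp p1 _ _ _] := exponent_cone_exponent.
apply: (@bounded_on_LvarI _ _ _ _ local_const mp p1).
- exact: local_const_ge1.
- move=> f mf; rewrite (local_maximalE (ltn0Sn n) mf).
  exact: measurable_cube_maximal.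
move=> f r mf r0 fr; rewrite (local_maximalE (ltn0Sn n) mf).
have mfr := measurable_div r mf.
apply: le_trans (modular_cube_maximal mfr fr).
apply: le_modular.
- exact: mp.
- exact: cone_exponent_gt0.
- by apply: measurable_div; exact: measurable_cube_maximal.
- exact: measurable_cube_maximal.
move=> x; rewrite (abse_divr _ r0) (lee_pdivrMl _ _ r0).
rewrite !gee0_abs; [exact: cube_maximal_scale|exact: cube_maximal_ge0|
  exact: cube_maximal_ge0].
Qed.

End local_bound.

(** * Unboundedness of the maximal operator *)

Section global_unbounded.
Context {R : realType} {n : nat} (s : R) (s1 : (1 <= s)%R).
Local Notation p := (@cone_exponent R n).

(** This choice of [L] gives [source] and [target] the volume [expR s]. [alpha] bounds the exponent
    below on [source], and [hull], the cube [[-L, 2L]^(n+1)], contains both. *)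
Let L : R := expR (s / n.+1%:R).
Let alpha : R := (3 + (2 * n.+1%:R + 1)^-1)%R.
Let source : set (Rn R n.+1) := cube [tuple L | i < n.+1] L.
Let target : set (Rn R n.+1) := cube [tuple (- L)%R | i < n.+1] L.
Let hull : set (Rn R n.+1) := cube [tuple (- L)%R | i < n.+1] (3 * L)%R.
Let f (x : Rn R n.+1) : \bar R := (\1_source x)%:E.

Let L1 : (1 <= L)%R.
Proof. by rewrite -[leLHS]expR0 ler_expR divr_ge0// (le_trans ler01). Qed.

Let L0 : (0 < L)%R. Proof. exact: expR_gt0. Qed.

Let LN : (L ^+ n.+1 = expR s)%R.
Proof. by rewrite -expRM_natl mulrCA divff ?mulr1// pnatr_eq0. Qed.

Let msource : measurable source. Proof. exact: measurable_cube. Qed.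

Let mf : measurable_fun setT f.
Proof. by apply/measurable_EFinP; exact: measurable_indic. Qed.

Lemma cone_exponent_source x : source x -> (alpha <= p x)%R.
Proof.
move=> xs; rewrite lerD2l.
have S0 := l1norm_ge0 x.
have S2 : (l1norm x <= 2 * n.+1%:R * L)%R.
  have -> : (2 * n.+1%:R * L = \sum_(i < n.+1) (2 * L))%R.
    by rewrite sumr_const card_ord -[RHS]mulr_natl; ring.
  apply: ler_sum => i _; have := xs i; rewrite tnth_mktuple => /andP[? ?].
  by rewrite ger0_norm; have := L0; lra.
have := xs ord0; rewrite tnth_mktuple => /andP[x0 _].
have n0 : (0 <= n.+1%:R :> R)%R by [].
rewrite ler_pdivlMr ?ltr_pwDl// mulrC ler_pdivrMr ?ltr_wpDl ?mulr_ge0//.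
have := L1; nra.
Qed.

Lemma cone_exponent_target x : target x -> (p x <= 3)%R.
Proof.
move=> xt; have := xt ord0; rewrite tnth_mktuple => /andP[_ x0].
rewrite gerDl pmulr_lle0 ?invr_gt0 ?ltr_pwDl ?l1norm_ge0//.
by lra.
Qed.

(** On [source] the exponent is at least [alpha], so the integrand is at most [expR (- s)], the
    inverse of the volume. *)
Lemma modular_source : modular p (fun x => f x / (expR (s / alpha))%:E) <= 1.
Proof.
have a0 : (0 < alpha)%R by rewrite ltr_pwDl// invr_ge0 addr_ge0// mulr_ge0.
have l0 : (0 < expR (s / alpha))%R by exact: expR_gt0.
apply: (@le_trans _ _
    (\int[leb R n.+1]_x ((expR (- s))%:E * (\1_source x)%:E))); last first.
  rewrite ge0_integralZl; [|exact: measurableT|exact: mf|by []|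
    by rewrite lee_fin expR_ge0].
  rewrite integral_indic; [|exact: measurableT|exact: msource].
  by rewrite setIT leb_cube// LN -EFinM -expRD addNr expR0.
have mp := @measurable_cone_exponent R n.
apply: ge0_le_integral.
- exact: measurableT.
- by move=> x _; exact: poweR_ge0.
- apply: measurable_modular; [exact: mp|exact: cone_exponent_gt0|].
  exact: measurable_div.
- exact: measurable_funeM.
move=> x _; rewrite abse_divr// /f indicE.
have [/set_mem xs|_] := boolP (x \in source); last first.
  by rewrite abse0 !mule0 poweR0r ?gt_eqF ?cone_exponent_gt0.
rewrite abse1 !mule1 poweR_EFin lee_fin -expRN -expRM ler_expR mulNr lerN2.
rewrite -mulrA mulrC -[leLHS]mul1r ler_pM//; first exact: le_trans ler01 s1.
by rewrite mulrC ler_pdivlMr// mul1r cone_exponent_source.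
Qed.

Lemma maximal_source_target x : target x -> (3 ^- n.+1)%:E <= maximal f x.
Proof.
move=> xt; apply: (@le_trans _ _ (average f hull)).
  rewrite average_cube ?mulr_gt0//.
  apply: (@le_trans _ _ (((3 * L) ^+ n.+1)^-1%:E * leb R n.+1 source)).
    rewrite leb_cube// -EFinM lee_fin exprMn invfM -mulrA mulVf ?mulr1//.
    by rewrite expf_neq0// gt_eqF.
  apply: lee_wpmul2l; first by rewrite lee_fin invr_ge0 exprn_ge0// mulr_ge0// ltW.
  have -> : leb R n.+1 source = \int[leb R n.+1]_(y in hull) (\1_source y)%:E.
    rewrite integral_indic; [|exact: measurable_cube|exact: msource].
    congr (leb R n.+1 _); rewrite setIidl// => y ys i.
    have := ys i; rewrite !tnth_mktuple => /andP[y1 y2].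
    by apply/andP; split; have := L0; lra.
  rewrite le_eqVlt; apply/orP; left; apply/eqP; apply: eq_integral => y _.
  by rewrite /f gee0_abs.
apply: ereal_sup_ubound; exists hull => //; split.
  by exists [tuple (- L)%R | i < n.+1], (3 * L)%R; rewrite ?mulr_gt0.
move=> i; have := xt i; rewrite !tnth_mktuple => /andP[y1 y2].
by apply/andP; split; have := L0; lra.
Qed.

(** For smaller [mu] the quotient is at least [w <= 1] on [target], where [p <= 3], so the modular
    is at least [w ^+ 3] times the volume [expR s]. Using [s - 1] in [w] makes this product
    [expR 1], strictly above [1]. *)
Lemma modular_maximal_source (mu : R) : (0 < mu)%R ->
  modular p (fun x => maximal f x / mu%:E) <= 1 ->
  (3 ^- n.+1 * expR ((s - 1) / 3) <= mu)%R.
Proof.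
move=> mu0 h; rewrite leNgt; apply/negP => mulow.
pose w : R := expR (- ((s - 1) / 3)).
have w0 : (0 < w)%R by exact: expR_gt0.
have w1 : (w <= 1)%R by rewrite expR_le1 oppr_le0 divr_ge0// subr_ge0.
have wmu : (w <= 3 ^- n.+1 / mu)%R.
  by rewrite ler_pdivlMr// /w expRN mulrC ler_pdivrMr ?expR_gt0// ltW.
have mp := @measurable_cone_exponent R n.
have mM : measurable_fun setT (maximal f).
  by rewrite maximalE; exact: measurable_cube_maximal.
have mt : measurable target by exact: measurable_cube.
have mint := measurable_modular mp (@cone_exponent_gt0 R n) (measurable_div mu mM).
suff : 1 < modular p (fun x => maximal f x / mu%:E) by rewrite ltNge h.
apply: (@lt_le_trans _ _ ((w ^+ 3)%:E * leb R n.+1 target)).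
  rewrite leb_cube// LN -EFinM lte_fin -expRM_natl -expRD.
  by rewrite (_ : _ + _ = 1)%R ?expR_gt1//; field.
rewrite -integral_cst//.
apply: (@le_trans _ _
    (\int[leb R n.+1]_(x in target) (`|maximal f x / mu%:E| `^ p x))); last first.
  apply: ge0_subset_integral; [exact: mt|exact: measurableT|exact: mint| |by []].
  by move=> x _; exact: poweR_ge0.
apply: ge0_le_integral.
- exact: mt.
- by move=> x _ /=; rewrite lee_fin exprn_ge0// ltW.
- exact: measurable_cst.
- exact: measurable_funTS.
move=> x xt /=; rewrite abse_divr//.
have /andP[p2 _] := cone_exponent_bounds x.
apply: (@le_trans _ _ (w%:E `^ p x)).
  rewrite poweR_EFin lee_fin -powR_mulrn ?(ltW w0)//.
  by apply: ger_powR; [rewrite w0|exact: cone_exponent_target].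
apply: ge0_le_poweR; [by lra|by rewrite lee_fin ltW|].
rewrite lee_pdivlMl//.
apply: le_trans (le_trans (maximal_source_target xt) (lee_abs _)).
by rewrite -EFinM lee_fin mulrC -ler_pdivlMr.
Qed.

Lemma Lvar_norm_maximal_source (C : R) :
  (forall g, Lvar p g -> Lvar_norm p (maximal g) <= C%:E * Lvar_norm p g) ->
  (3 ^- n.+1 * expR ((s - 1) / 3) <= `|C| * expR (s / alpha))%R.
Proof.
move=> HC.
have fL : Lvar p f.
  split; first exact: mf.
  exists (expR (s / alpha)); first exact: expR_gt0.
  by rewrite (le_lt_trans modular_source)// ltry.
have norm_f0 : 0 <= Lvar_norm p f.
  by apply: le_ereal_inf_tmp => _ [r [r0 _] <-]; rewrite lee_fin ltW.
rewrite -lee_fin; apply: (@le_trans _ _ (Lvar_norm p (maximal f))).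
  apply: le_ereal_inf_tmp => _ [mu [mu0 hmu] <-]; rewrite lee_fin.
  exact: modular_maximal_source.
(* Boundedness provides a real [C] of unknown sign, hence the absolute value. *)
apply: (le_trans (HC _ fL)); apply: (@le_trans _ _ (`|C|%:E * Lvar_norm p f)).
  by apply: lee_wpmul2r => //; rewrite lee_fin ler_norm.
rewrite EFinM; apply: lee_wpmul2l; first by rewrite lee_fin.
apply: ereal_inf_lbound; exists (expR (s / alpha)) => //.
by split; [exact: expR_gt0|exact: modular_source].
Qed.

End global_unbounded.

(** Comparing the two norms gives [expR (s * d) <= D] with [d = 1/3 - 1/alpha > 0] and [D]
    independent of [s]; the factor [expR 3^-1] in [D] comes from the [s - 1] above. *)
Lemma cone_exponent_notin_calB (R : realType) (n : nat) :
  ~ calB R n.+1 (@cone_exponent R n).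
Proof.
case=> _ [C HC].
have {}HC g : Lvar (@cone_exponent R n) g ->
    Lvar_norm (@cone_exponent R n) (maximal g) <=
    C%:E * Lvar_norm (@cone_exponent R n) g by move=> /HC[].
pose alpha : R := (3 + (2 * n.+1%:R + 1)^-1)%R.
have a3 : (3 < alpha)%R by rewrite ltrDl invr_gt0 ltr_wpDl// mulr_ge0.
have a0 : (0 < alpha)%R by exact: lt_trans a3.
pose d : R := (3^-1 - alpha^-1)%R.
have d0 : (0 < d)%R by rewrite subr_gt0 ltf_pV2 ?posrE.
pose D : R := (`|C| * 3 ^+ n.+1 * expR 3^-1)%R.
have D0 : (0 <= D)%R by rewrite !mulr_ge0 ?expR_ge0 ?exprn_ge0.
(* With [s = 1 + D / d], [expR (s * d)] is at least [1 + s * d = 1 + d + D], which exceeds [D]. *)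
have s1 : (1 <= 1 + D / d)%R by rewrite lerDl divr_ge0// ltW.
have := Lvar_norm_maximal_source s1 HC.
set s := (1 + D / d)%R; rewrite -/alpha mulrC ler_pdivrMr ?exprn_gt0// => h.
have : (expR (s * d) <= D)%R.
  rewrite (_ : s * d = (s - 1) / 3 + (3^-1 - s / alpha))%R; last first.
    by rewrite /d; field; rewrite gt_eqF.
  rewrite expRD expRB mulrA ler_pdivrMr ?expR_gt0//.
  apply: le_trans (ler_wpM2r (expR_ge0 _) h) _.
  by rewrite /D le_eqVlt; apply/orP; left; apply/eqP; ring.
apply/negP; rewrite -ltNge; apply: lt_le_trans (expR_ge1Dx _).
rewrite /s mulrDl mul1r divfK ?gt_eqF//; lra.
Qed.

Theorem theorem2p4 (R : realType) (n : nat) (n_ge1 : (1 <= n)%N) :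
  calB R n <> calBloc R n.
Proof.
case: n n_ge1 => [|n] n_ge1.
  by exfalso; move: n_ge1; rewrite ltnn.
move=> E.
apply: (@cone_exponent_notin_calB R n).
rewrite E.
exact: cone_exponent_calBloc.
Qed.
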